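(* Let $(X,d)$ be a uniformly perfect metric space and let $E\subset X$. Then $E$ is fat if and only if $E$ is quasisymmetrically thick, and $E$ is thin if and only if $E$ is quasisymmetrically null.
   Context: $B(x,r)=\{y\in X: d(x,y)\le r\}$, $r>0$, denotes the closed ball; $\mathcal{H}^q$ is the $q$-dimensional Hausdorff measure. A metric space $X$ is uniformly perfect (with constant $D$) if it is not a singleton and there is a constant $D\ge 1$ such that for all $x\in X$ and $r>0$: $X\setminus B(x,r)\ne\emptyset$ implies $B(x,r)\setminus B(x,r/D)\neq\emptyset$. A Borel regular outer measure $\mu$ on a metric space $(X,d)$ is doubling if there is a constant $C\ge 1$ (depending only on $\mu$) such that $0<\mu(B(x,2r))\le C\mu(B(x,r))<\infty$ for all $x\in X$ and $r>0$. $\mathcal{D}(X)$ denotes the collection of all doubling measures on $X$. A set $A\subset X$ is fat if $\mu(A)>0$ for every $\mu\in\mathcal{D}(X)$, and thin if $\mu(A)=0$ for every $\mu\in\mathcal{D}(X)$. A homeomorphism $f$ from a metric space $(X,d_X)$ onto a metric space $(Y,d_Y)$ is quasisymmetric if there is a homeomorphism $\eta\colon[0,\infty)\to[0,\infty)$ such that for any three distinct points $x,y,z\in X$, $$\frac{d_Y(f(x),f(y))}{d_Y(f(x),f(z))}\le\eta\left(\frac{d_X(x,y)}{d_X(x,z)}\right).$$ For $0<q<\infty$, a metric space $Y$ is Ahlfors $q$-regular if there is a constant $K\ge1$ such that $K^{-1}r^q\le\mathcal{H}^q(B(y,r))\le K r^q$ for all $y\in Y$ and $0<r<\operatorname{diam}(Y)$.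 A set $E\subset X$ is quasisymmetrically thick (respectively, quasisymmetrically null) if $\mathcal{H}^q(f(E))>0$ (respectively, $\mathcal{H}^q(f(E))=0$) whenever $f\colon X\to Y$ is a quasisymmetric homeomorphism from $X$ onto an Ahlfors $q$-regular space $Y$; here $q$ is allowed to depend on $Y$.
   Formalization: Ahlfors regularity is required for 0<r≤diam(Y) (r finite) instead of 0<r<diam(Y), so a bounded Y has finite measure; with strict inequality the claim fails for infinitely many copies of [0,1] at mutual distance 1. *)

(* Defs.v *)
From HB Require Import structures.
From mathcomp Require Export all_boot all_order all_algebra.
From mathcomp Require Export all_classical all_reals all_analysis.
Export Order.TTheory GRing.Theory Num.Theory.
Export numFieldNormedType.Exports.

Set Implicit Arguments.
Unset Strict Implicit.
Unset Printing Implicit Defensive.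

Local Open Scope classical_set_scope.
Local Open Scope ring_scope.
Local Open Scope ereal_scope.

(* The library's [closed_ball] is the closure of the open ball, which in a
   general metric space may be smaller than this set. *)
Definition cball {R : realType} {X : metricType R} (x : X) (r : R) : set X :=
  [set y | (mdist x y <= r)%R].

(* [maxe 0] only serves to get [diam set0 = 0] (the supremum of [set0] in
   [\bar R] is [-oo]). *)
Definition diam {R : realType} {X : metricType R} (A : set X) : \bar R :=
  maxe 0 (ereal_sup [set (mdist p.1 p.2)%:E | p in A `*` A]).

Definition hausdorff_content {R : realType} {X : metricType R}
    (q delta : R) (A : set X) : \bar R :=
  ereal_inf [set \sum_(0 <= n <oo) diam (U n) `^ q | U in
    [set U : (set X)^nat | A `<=` \bigcup_n U n /\
                           forall n, diam (U n) <= delta%:E]].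

(* The contents increase as [delta] decreases, so the supremum is the limit as
   [delta] tends to 0. No normalizing constant is used. *)
Definition hausdorff_measure {R : realType} {X : metricType R}
    (q : R) (A : set X) : \bar R :=
  ereal_sup [set hausdorff_content q delta A | delta in [set d : R | (0 < d)%R]].

Definition uniformly_perfect {R : realType} (X : metricType R) : Prop :=
  ~ (exists x : X, [set: X] = [set x]) /\
  exists2 D : R, (1 <= D)%R & forall (x : X) (r : R), (0 < r)%R ->
    [set: X] `\` cball x r !=set0 -> cball x r `\` cball x (r / D)%R !=set0.

Definition borel {R : realType} {X : metricType R} : set (set X) :=
  <<s [set U : set X | open U] >>.

Definition borel_regular {R : realType} {X : metricType R}
    (mu : {outer_measure set X -> \bar R}) : Prop :=
  (forall B : set X, borel B -> mu.-caratheodory B) /\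
  forall A : set X, exists B : set X, [/\ borel B, A `<=` B & mu B = mu A].

Definition doubling_measures {R : realType} (X : metricType R) :
    set {outer_measure set X -> \bar R} :=
  [set mu | borel_regular mu /\
    exists2 C : R, (1 <= C)%R & forall (x : X) (r : R), (0 < r)%R ->
      [/\ 0 < mu (cball x (2 * r)%R),
          mu (cball x (2 * r)%R) <= C%:E * mu (cball x r)
        & C%:E * mu (cball x r) < +oo]].
Arguments doubling_measures {R} X.

Definition fat {R : realType} {X : metricType R} (A : set X) : Prop :=
  forall mu, doubling_measures X mu -> 0 < mu A.

Definition thin {R : realType} {X : metricType R} (A : set X) : Prop :=
  forall mu, doubling_measures X mu -> mu A = 0.

Definition homeomorphism {S T : topologicalType} (f : S -> T) : Prop :=
  exists g : T -> S,
    [/\ cancel f g, cancel g f, continuous f & continuous g].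

Definition homeomorphism_on {S T : topologicalType} (A : set S) (B : set T)
    (f : S -> T) : Prop :=
  exists g : T -> S,
    [/\ set_fun A B f, set_fun B A g,
        {in A, cancel f g} /\ {in B, cancel g f},
        {within A, continuous f} & {within B, continuous g}].

(* [eta] is a total function of which only the restriction to [0, +oo[
   matters. *)
Definition quasisymmetric {R : realType} {X Y : metricType R} (f : X -> Y) :
    Prop :=
  homeomorphism f /\
  exists2 eta : R -> R, @homeomorphism_on R R `[0%R, +oo[ `[0%R, +oo[ eta &
    forall x y z : X, x <> y -> y <> z -> x <> z ->
      (mdist (f x) (f y) / mdist (f x) (f z)
         <= eta (mdist x y / mdist x z))%R.

(* The radius [r = diam Y] is included when [Y] is bounded. This amounts to also
   requiring that a bounded [Y] have finite measure, which the bounds for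
   [r < diam Y] do not imply: if the disjoint union of infinitely many copies of
   [0, 1] is given distance 1 between points of different copies, they hold with
   [q = 1] and [K = 2] although [Y = B(y, 1)] has infinite measure. *)
Definition ahlfors_regular {R : realType} (q : R) (Y : metricType R) : Prop :=
  exists2 K : R, (1 <= K)%R & forall (y : Y) (r : R), (0 < r)%R ->
    r%:E <= diam [set: Y] ->
    (K^-1 * r `^ q)%:E <= hausdorff_measure q (cball y r) <= (K * r `^ q)%:E.

Definition quasisymmetrically_thick {R : realType} {X : metricType R}
    (E : set X) : Prop :=
  forall (q : R) (Y : metricType R) (f : X -> Y), (0 < q)%R ->
    ahlfors_regular q Y -> quasisymmetric f -> 0 < hausdorff_measure q (f @` E).

Definition quasisymmetrically_null {R : realType} {X : metricType R}
    (E : set X) : Prop :=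
  forall (q : R) (Y : metricType R) (f : X -> Y), (0 < q)%R ->
    ahlfors_regular q Y -> quasisymmetric f -> hausdorff_measure q (f @` E) = 0.

(* Main.v *)
(** If [f : X -> Y] is quasisymmetric and [Y] is Ahlfors [q]-regular, then
    [A |-> H^q (f A)] is a doubling measure on [X]: by uniform perfectness, for a
    ball [B(x, r) <> X] there is [z] with [r / D < d(x, z) <= r], and
    quasisymmetry traps the image of [B(x, r)] between two balls with radii
    comparable to [d(f x, f z)]. Conversely, let [mu] be doubling. The quasi-metric
    [delta(x, y) = mu B(x, d(x, y)) + mu B(y, d(x, y))] has, for [q] large, a power
    [delta^(1/q)] comparable to a metric [rho] (Frink). Since [mu] is doubling and,
    by uniform perfectness, reverse doubling, the identity [X -> (X, rho)] is
    quasisymmetric and [mu] of a [rho]-ball of radius [r] is comparable to [r^q].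
    Hence [(X, rho)] is Ahlfors [q]-regular, [mu] is dominated by a multiple of
    [H^q], and [mu]-null sets are [H^q]-null. *)

From HB Require Import structures.
Require Import Defs.
From mathcomp Require Import ring lra zify.

Set Implicit Arguments.
Unset Strict Implicit.
Unset Printing Implicit Defensive.

Local Open Scope classical_set_scope.
Local Open Scope ring_scope.

(** * Frink metrization *)

(** Three steps of a chain cost the quasi-metric a factor [2 * C ^ 3]; Frink's argument tolerates
    only 2, and taking a [q]-th root with [2 * C ^ 3 <= 2 ^ q] closes the gap. Two obstacles shape
    the rest. Balls of the new metric are not balls of the old one: each is compared with balls
    whose radius is a supremum or an infimum of distances. These need not be attained, since [X] may
    be totally disconnected, so points at comparable distance replace extremal ones, at the cost of
    doubling constants. Moreover, [H^q] is bounded by a multiple of [mu] through packing balls in a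
    neighborhood of the set; in the limit this sees the closure, and a null set may be dense. The
    bound is therefore first available for closed bounded sets. Null sets are reached through a
    Borel hull and the inner regularity of [H^q] by closed sets, which uses the finiteness of [H^q]
    on balls but neither completeness nor separability. *)

Section frink.
Context {R : realType} {T : choiceType} (delta : T -> T -> R).
Hypothesis delta_ge0 : forall x y, 0 <= delta x y.
Hypothesis deltaxx : forall x, delta x x = 0.
Hypothesis delta_sym : forall x y, delta x y = delta y x.
Hypothesis delta_eq0 : forall x y, delta x y = 0 -> x = y.
Hypothesis delta_quasi : forall a b c d s,
  delta a b <= s -> delta b c <= s -> delta c d <= s -> delta a d <= 2 * s.

(** As for [path], the starting point is kept apart from the list, so that the chain ends at
    [last x p] and the empty list is a chain from [x] to itself. *)
Fixpoint chain_length (x : T) (p : seq T) : R :=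
  if p is y :: p' then delta x y + chain_length y p' else 0.

Lemma chain_length_ge0 x p : 0 <= chain_length x p.
Proof. by elim: p x => //= y p ih x; rewrite addr_ge0. Qed.

Lemma chain_length_cat x p p' :
  chain_length x (p ++ p') = chain_length x p + chain_length (last x p) p'.
Proof. by elim: p x => [|y p ih] x /=; rewrite ?add0r// ih addrA. Qed.

Lemma chain_length_rev x p :
  chain_length (last x p) (rev (belast x p)) = chain_length x p.
Proof.
elim: p x => //= y p ih x; rewrite rev_cons -cats1 chain_length_cat ih /= addr0.
rewrite addrC; congr (_ + _); rewrite delta_sym; congr (delta _ _).
by case: p {ih} => //= z p; rewrite rev_cons last_rcons.
Qed.

Lemma chain_split x p t : 0 <= t -> t < chain_length x p ->
  exists p1 y p2, [/\ p = p1 ++ y :: p2, chain_length x p1 <= t &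
    t < chain_length x p1 + delta (last x p1) y].
Proof.
elim: p x t => [|y p ih] x t t0 /=; first by rewrite ltNge t0.
have [yt _|ty] := ltP t (delta x y).
  by exists [::], y, p; split; rewrite //= add0r.
rewrite -ltrBlDl => /ih[|p1 [z [p2 [-> p1t tz]]]]; first by rewrite subr_ge0.
exists (y :: p1), z, p2; split=> //=; lra.
Qed.

(* A chain is cut at the edge containing its midpoint; the two remaining chains
   are shorter than half of it. *)
Lemma frink_chain x p : delta x (last x p) <= 4 * chain_length x p.
Proof.
have [n] := ubnP (size p); elim: n x p => // n ih x p pn.
(* A chain of length zero is constant; it is set apart because no edge of it contains a midpoint. *)
have := chain_length_ge0 x p; rewrite le_eqVlt => /orP[/eqP S0|S0].
  suff -> : last x p = x by rewrite deltaxx mulr_ge0 ?chain_length_ge0.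
  elim: p x S0 {pn} => //= y p ihp x S0.
  have := chain_length_ge0 y p; have := delta_ge0 x y => h1 h2.
  have /delta_eq0 -> : delta x y = 0 by lra.
  by apply: ihp; lra.
have [||p1 [y [p2 [pE p1S p2S]]]] := @chain_split x p (chain_length x p / 2).
- lra.
- lra.
have SE : chain_length x p =
    chain_length x p1 + (delta (last x p1) y + chain_length y p2).
  by rewrite {1}pE chain_length_cat.
have h1 : delta x (last x p1) <= 4 * chain_length x p1.
  by apply: ih; move: pn; rewrite pE size_cat /=; lia.
have h2 : delta y (last y p2) <= 4 * chain_length y p2.
  by apply: ih; move: pn; rewrite pE size_cat /=; lia.
have -> : last x p = last y p2 by rewrite pE last_cat.
have := chain_length_ge0 x p1; have := chain_length_ge0 y p2; move=> p20 p10.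
(* Let [L] be the length of the chain. By induction each half, of length at most [L / 2],
   contributes at most [2 * L], and so does the cut edge; [delta_quasi] doubles this, which
   reproduces the constant 4. *)
have -> : 4 * chain_length x p = 2 * (2 * chain_length x p) by ring.
by apply: (delta_quasi (b := last x p1) (c := y)); lra.
Qed.

(** This is the largest pseudometric bounded by [delta]. *)
Definition chain_dist (x y : T) : R :=
  inf [set chain_length x p | p in [set p | last x p = y]].

Let chain_lb x y : lbound [set chain_length x p | p in [set p | last x p = y]]
  0.
Proof. by move=> _ [p _ <-]; exact: chain_length_ge0. Qed.

Let chain_has_inf x y :
  has_inf [set chain_length x p | p in [set p | last x p = y]].
Proof. by split; [exists (chain_length x [:: y]), [:: y]|exists 0;
  exact: chain_lb]. Qed.

Lemma chain_dist_le x p : chain_dist x (last x p) <= chain_length x p.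
Proof. by apply: ge_inf; [exists 0; exact: chain_lb|exists p]. Qed.

Lemma chain_dist_ge x y c :
  (forall p, last x p = y -> c <= chain_length x p) -> c <= chain_dist x y.
Proof.
move=> h; apply: lb_le_inf; first by have [] := chain_has_inf x y.
by move=> _ [p py <-]; exact: h.
Qed.

Lemma chain_dist_le_delta x y : chain_dist x y <= delta x y.
Proof. by have := chain_dist_le x [:: y]; rewrite /= addr0. Qed.

Lemma delta_le_chain_dist x y : delta x y <= 4 * chain_dist x y.
Proof.
rewrite -ler_pdivrMl//; apply: chain_dist_ge => p <-.
by rewrite ler_pdivrMl//; exact: frink_chain.
Qed.

Lemma chain_distxx x : chain_dist x x = 0.
Proof.
apply/eqP; rewrite eq_le -{1}(deltaxx x) chain_dist_le_delta /=.
by apply: chain_dist_ge => p _; exact: chain_length_ge0.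
Qed.

Lemma chain_dist_eq0 x y : chain_dist x y = 0 -> x = y.
Proof.
move=> e; apply: delta_eq0; apply/eqP; rewrite eq_le delta_ge0 andbT.
by have := delta_le_chain_dist x y; rewrite e mulr0.
Qed.

Let chain_dist_sym_le x y : chain_dist x y <= chain_dist y x.
Proof.
apply: chain_dist_ge => p <-; rewrite -chain_length_rev.
have e : last (last y p) (rev (belast y p)) = y.
  by case: p => //= z p; rewrite rev_cons last_rcons.
by move: (chain_dist_le (last y p) (rev (belast y p))); rewrite e.
Qed.

Lemma chain_dist_sym x y : chain_dist x y = chain_dist y x.
Proof. by apply/eqP; rewrite eq_le !chain_dist_sym_le. Qed.

Lemma chain_dist_triangle y x z :
  chain_dist x z <= chain_dist x y + chain_dist y z.
Proof.
rewrite -lerBlDr; apply: chain_dist_ge => p py.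
rewrite lerBlDr addrC -lerBlDr; apply: chain_dist_ge => p' pz.
rewrite lerBlDr addrC; move: pz; rewrite -py -chain_length_cat => pz.
by rewrite (_ : z = last x (p ++ p')) ?chain_dist_le// last_cat pz.
Qed.

End frink.

(** The space to be remetrized already carries a metric; a copy indexed by [rho] keeps the two
    structures apart. *)
Definition metrized {T : Type} {R : Type} (rho : T -> T -> R) := T.

HB.instance Definition _ (T : choiceType) (R : Type) (rho : T -> T -> R) :=
  Choice.copy (metrized rho) T.

Section metrized.
Context {R : realType} {T : choiceType} (rho : T -> T -> R).
Hypothesis rhoxx : forall x, rho x x = 0.
Hypothesis rho_eq0 : forall x y, rho x y = 0 -> x = y.
Hypothesis rho_sym : forall x y, rho x y = rho y x.
Hypothesis rho_triangle : forall y x z, rho x z <= rho x y + rho y z.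

Lemma exists_metric_structure : exists (Y : metricType R) (f : T ->
  Y) (g : Y -> T),
  [/\ cancel f g, cancel g f & forall x y, mdist (f x) (f y) = rho x y].
Proof.
pose Y : metricType R := HB.pack (metrized rho)
  (@isMetric.Build R (metrized rho) rho rhoxx rho_eq0 rho_sym rho_triangle).
by exists Y, id, id.
Qed.

End metrized.

(** * Power-type quasisymmetry functions *)

Section power_homeomorphism.
Context {R : realType}.
Implicit Types t s p c W : R.

Lemma within_continuous_powR p c : 0 < p ->
  {within `[0, +oo[, continuous (fun t : R => c * t `^ p)}.
Proof.
move=> p0; apply/continuous_within_itvcyP; split.
- move=> t t0.
  have ct : {for t, continuous (fun x : R => x `^ p)}.
    apply: differentiable_continuous; apply/derivable1_diffP.
    exact: derivable_powR.
  by apply: cvgM; [exact: cvg_cst|exact: ct].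
- rewrite powR0 ?gt_eqF// mulr0.
  rewrite -[X in _ --> X](mulr0 c).
  by apply: cvgM; [exact: cvg_cst|exact: powR_cvg0].
Qed.

Lemma powRK p t : 0 < p -> 0 <= t -> (t `^ p) `^ p^-1 = t.
Proof. by move=> p0 t0; rewrite -powRrM mulfV ?gt_eqF// powRr1. Qed.

Lemma powRVK p t : 0 < p -> 0 <= t -> (t `^ p^-1) `^ p = t.
Proof. by move=> p0 t0; rewrite -powRrM mulVf ?gt_eqF// powRr1. Qed.

(** The usual power-type control function: for [p >= 1] the first power prevails when [t >= 1], the
    second when [t <= 1]. *)
Definition power_max W p t := Num.max (W * t `^ p) (W * t `^ p^-1).

(** The inverse of [power_max]. The powers of [s / W] are expanded so that continuity follows from
    [within_continuous_powR]. *)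
Let power_min W p s := Num.min (W^-1 `^ p^-1 * s `^ p^-1) (W^-1 `^ p * s `^ p).

Let le_powR p p' t : 1 <= t -> p <= p' -> t `^ p <= t `^ p'.
Proof. by move=> t1 pp; rewrite ler_powR. Qed.

Let ge_powR p p' t : 0 < p -> 0 <= t <= 1 -> p <= p' -> t `^ p' <= t `^ p.
Proof.
move=> p0 /andP[+ t1] pp; rewrite le_eqVlt => /orP[/eqP<-|t0].
  by rewrite !powR0// gt_eqF// (lt_le_trans p0).
by apply: ger_powR => //; rewrite t0.
Qed.

Let powR_le1 p t : 0 < p -> 0 <= t <= 1 -> t `^ p <= 1.
Proof.
move=> p0 /andP[t0 t1]; rewrite -[leRHS](congr1 (@^~ p) (powR1 R)).
by rewrite ge0_ler_powR ?nnegrE// ltW.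
Qed.

Lemma power_max_homeomorphism W p : 0 < W -> 1 <= p ->
  @homeomorphism_on R R `[0, +oo[ `[0, +oo[ (power_max W p).
Proof.
move=> W0 p1; have p0 : 0 < p by exact: lt_le_trans p1.
have iv : p^-1 <= p by rewrite (le_trans _ p1)// invf_le1.
have ip0 : 0 < p^-1 by rewrite invr_gt0.
have pm1 t : 1 <= t -> power_max W p t = W * t `^ p.
  by move=> t1; rewrite /power_max; apply/max_idPl; rewrite ler_pM2l// le_powR.
have pm0 t : 0 <= t <= 1 -> power_max W p t = W * t `^ p^-1.
  by move=> t1; rewrite /power_max; apply/max_idPr; rewrite ler_pM2l// ge_powR.
have pnE s : 0 <= s -> power_min W p s = Num.min ((s / W) `^ p^-1) ((s / W) `^
  p).
  by move=> s0; rewrite /power_min -!powRM ?invr_ge0 ?(ltW W0)// ![W^-1 *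
    s]mulrC.
have pn1 s : W <= s -> power_min W p s = (s / W) `^ p^-1.
  move=> sW; rewrite pnE ?(le_trans (ltW W0))//; apply/min_idPl;
    apply: le_powR => //.
  by rewrite ler_pdivlMr// mul1r.
have pn0 s : 0 <= s <= W -> power_min W p s = (s / W) `^ p.
  move=> /andP[s0 sW]; rewrite pnE//; apply/min_idPr; apply: ge_powR => //.
  by rewrite divr_ge0 ?(ltW W0)//= ler_pdivrMr// mul1r.
exists (power_min W p); split.
- move=> t /=; rewrite !in_itv /= !andbT => t0.
  by rewrite /power_max le_max mulr_ge0// ?powR_ge0// ltW.
- move=> t /=; rewrite !in_itv /= !andbT => t0.
  by rewrite /power_min le_min !mulr_ge0// powR_ge0.
- split=> t; rewrite inE /= in_itv /= andbT => t0.
  + have [t1|/ltW t1] := leP 1 t.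
      rewrite pm1// pn1 ?ler_peMr ?(ltW W0)//;
        last by rewrite -(powRr0 t) ler_powR// ltW.
      by rewrite mulrAC mulfV ?gt_eqF// mul1r powRK.
    rewrite pm0 ?t0// pn0; last first.
      rewrite mulr_ge0 ?powR_ge0 ?(ltW W0)//= ler_piMr ?(ltW W0)//.
      by apply: powR_le1; rewrite ?t0.
    by rewrite mulrAC mulfV ?gt_eqF// mul1r powRVK.
  + have [tW|/ltW tW] := leP W t.
      have tW1 : 1 <= t / W by rewrite ler_pdivlMr// mul1r.
      rewrite pn1// pm1; first by rewrite powRVK ?divr_ge0 ?(ltW W0)// mulrC
        divfK ?gt_eqF.
      by rewrite -(powRr0 (t / W)) ler_powR// ltW.
    have tW1 : 0 <= t / W <= 1 by rewrite divr_ge0 ?(ltW W0)//= ler_pdivrMr//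
      mul1r.
    have /andP[tW0 tWl] := tW1.
    rewrite pn0 ?t0// pm0; first by rewrite powRK// mulrC divfK ?gt_eqF.
    by rewrite powR_ge0 /= powR_le1.
- by apply: max_fun_continuous; exact: within_continuous_powR.
- by apply: min_fun_continuous; exact: within_continuous_powR.
Qed.

(* The interpolation behind the quasisymmetry function [power_max]: a ratio
   controlled by some power of [t] on either side of [1]. *)
Lemma le_power_max (r t P : R) (q a b : nat) : (0 < q)%N -> (0 < b)%N ->
  0 <= r -> 0 < t -> 1 <= P ->
  (1 <= t -> r ^+ q <= P * t ^+ a) -> (t <= 1 -> r ^+ (q * b) <= P * t) ->
  r <= power_max P (a + q * b)%N%:R t.
Proof.
move=> q0 b0 r0 t0 P1 hbig hsmall; have t0' := ltW t0.
have N0 : (0 < a + q * b)%N by rewrite addn_gt0 muln_gt0 q0 b0 orbT.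
have P0 : 0 < P by exact: lt_le_trans P1.
rewrite /power_max le_max; apply/orP.
have [t1|/ltW t1] := leP 1 t; [left|right].
  rewrite powR_mulrn//.
  have tN : 1 <= t ^+ (a + q * b) by rewrite exprn_ege1.
  have [r1|/ltW r1] := leP r 1.
    by rewrite (le_trans r1)// -[leLHS]mulr1 ler_pM.
  apply: (@le_trans _ _ (r ^+ q)); first by rewrite -[leLHS]expr1 ler_weXn2l.
  by apply: (le_trans (hbig t1)); rewrite ler_pM2l// ler_weXn2l// leq_addr.
have tN0 : 0 <= t `^ (a + q * b)%:R^-1 by exact: powR_ge0.
have [r1|/ltW r1] := leP r 1; last first.
  apply: (@le_trans _ _ (r ^+ (q * b))).
    by rewrite -[leLHS]expr1 ler_weXn2l// muln_gt0 q0.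
  apply: (le_trans (hsmall t1)); rewrite ler_pM2l//.
  by rewrite ger1_powR ?t0// invf_le1 ?ltr0n// ler1n.
(* With [N = a + q * b] and [r <= 1], one has [r ^ N <= r ^ (q * b) <= P * t <= P ^ N * t], and an
   [N]-th root concludes. *)
rewrite -(@ler_pXn2r _ (a + q * b)) ?nnegrE ?mulr_ge0 ?(ltW P0)//.
rewrite exprMn -[X in _ * X]powR_mulrn// powRVK ?ltr0n//.
apply: (@le_trans _ _ (r ^+ (q * b))).
  by rewrite ler_wiXn2l// leq_addl.
apply: (le_trans (hsmall t1)); rewrite ler_pM2r//.
by rewrite -[leLHS]expr1 ler_weXn2l.
Qed.

End power_homeomorphism.

Lemma exp_sandwich {R : realType} (L u : R) : 2 <= L -> 1 <= u ->
  exists j : nat, L ^+ j <= u < L ^+ j.+1.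
Proof.
move=> L2 u1.
have ex : exists n, u < L ^+ n.
  exists (Num.bound u); apply: lt_le_trans (archi_boundP _) _; first by lra.
  apply: (@le_trans _ _ (2 ^+ Num.bound u)); last by rewrite lerXn2r ?nnegrE;
    lra.
  by rewrite -natrX ler_nat ltnW// ltn_expl.
case: (ex_minnP ex) => -[|j]; first by rewrite expr0 ltNge u1.
move=> uj min; exists j; rewrite uj andbT leNgt; apply/negP => /min.
by rewrite ltnn.
Qed.

Lemma exists_exp_ge {R : realType} (c : R) : exists n : nat, c <= 2 ^+ n.
Proof.
exists (Num.bound `|c|); apply: le_trans (ler_norm c) _.
apply: le_trans (ltW (archi_boundP (normr_ge0 c))) _.
by rewrite -natrX ler_nat ltnW// ltn_expl.
Qed.

Lemma exists_exp_le {R : realType} (theta e : R) : 0 <= theta < 1 -> 0 < e ->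
  exists n : nat, theta ^+ n <= e.
Proof.
move=> /andP[t0 t1] e0.
have : (fun n => theta ^+ n) @ \oo --> (0 : R) by apply: cvg_expr;
  rewrite ger0_norm.
move=> /cvgrPdist_le/(_ e e0)[n _ /(_ n (leqnn n))] /=.
by rewrite sub0r normrN => h; exists n; exact: le_trans (ler_norm _) h.
Qed.

Local Open Scope ereal_scope.

(** * Outer measures on metric spaces *)

Lemma exists_invSn_lt {R : realType} (d : R) :
  (0 < d)%R -> exists n : nat, (n.+1%:R^-1 < d)%R.
Proof.
move=> d0; exists (Num.truncn d^-1).
by rewrite invf_plt ?posrE ?ltr0n// truncnS_gt.
Qed.

Section caratheodory_continuity.
Context {R : realType} {T : Type} (mu : {outer_measure set T -> \bar R}).

(** Continuity from below, phrased as a bound: the successive differences are disjoint, and each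
    partial sum of their measures is the measure of some [A n]. *)
Lemma caratheodory_bigcup_le (A : (set T)^nat) (c : \bar R) :
  (forall n, mu.-caratheodory (A n)) -> nondecreasing_seq A ->
  (forall n, mu (A n) <= c) -> mu (\bigcup_n A n) <= c.
Proof.
move=> mA ndA Ac; rewrite -eq_bigcup_seqD.
apply: (le_trans (outer_measure_sigma_subadditive mu _)).
apply: lime_le; first by apply: is_cvg_nneseries => n _ _;
  exact: outer_measure_ge0.
apply: nearW => n; rewrite big_mkord.
have mD k : mu.-caratheodory (seqD A k).
  by case: k => [|k] //=; exact: caratheodory_measurable_setD.
have -> : \sum_(k < n) mu (seqD A k) = mu (\big[setU/set0]_(k < n) seqD A k).
  rewrite -[X in mu X]setTI caratheodory_additive//; last exact: trivIset_seqD.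
  by apply: eq_bigr => i _; rewrite setTI.
case: n => [|n].
  by rewrite big_ord0 outer_measure0 (le_trans _ (Ac 0%N)) ?outer_measure_ge0.
rewrite (_ : \big[setU/set0]_(k < n.+1) _ = A n)//.
by rewrite nondecreasing_bigsetU_seqD.
Qed.

(** Continuity from above, obtained from continuity from below by taking complements in [A 0], which
    has finite measure. *)
Lemma caratheodory_bigcap_ge (A : (set T)^nat) (c : \bar R) :
  (forall n, mu.-caratheodory (A n)) -> nonincreasing_seq A ->
  mu (A 0%N) < +oo -> (forall n, c <= mu (A n)) -> c <= mu (\bigcap_n A n).
Proof.
move=> mA niA A0 cA.
have mI : mu.-caratheodory (\bigcap_n A n).
  rewrite -(setCK (\bigcap_n A n)) setC_bigcap.
  by apply/caratheodory_measurable_setC/caratheodory_measurable_bigcup => n;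
    exact: caratheodory_measurable_setC.
have I0 : \bigcap_n A n `<=` A 0%N by move=> x; exact.
have finA B : B `<=` A 0%N -> mu B \is a fin_num.
  move=> BA; rewrite ge0_fin_numE ?outer_measure_ge0//.
  by rewrite (le_lt_trans _ A0)// le_outer_measure.
have An0 n : A n `<=` A 0%N by apply/subsetPset/niA.
have [r [cr r0]] : exists r : R, c <= r%:E /\ forall s : R, s%:E <= c ->
  (s <= r)%R.
  have := cA 0%N; rewrite -(fineK (finA _ (@subset_refl _ _))).
  case: c {cA} => [s| |] // cs; first by exists s; split.
  by exists (fine (mu (A 0%N))).
rewrite leNgt; apply/negP => Ic.
have DA n : mu (A 0%N `\` A n) <= mu (A 0%N) - c.
  have := mA n (A 0%N); rewrite (setIidr (An0 n)) -setDE => e.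
  move: (cA n) e; rewrite -(fineK (finA _ (@subset_refl _ _))).
  rewrite -(fineK (finA _ (An0 n))) -(fineK (finA _ (@subDsetl _ _ _))).
  case: c {cA cr r0 Ic} => [s| |]//= h [e]; last by rewrite leey.
  by rewrite -EFinB lee_fin; rewrite lee_fin in h; lra.
have : mu (A 0%N `\` \bigcap_n A n) <= mu (A 0%N) - c.
  rewrite setDE setC_bigcap setI_bigcupr.
  apply: caratheodory_bigcup_le => [n|m n mn|n]; last by rewrite -setDE.
  - by apply: caratheodory_measurable_setI => //;
    exact: caratheodory_measurable_setC.
  - by apply/subsetPset; apply: setIS; apply: subsetC; apply/subsetPset/niA.
have := mI (A 0%N); rewrite (setIidr I0) -setDE.
move: Ic; rewrite -(fineK (finA _ (@subset_refl _ _))).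
rewrite -(fineK (finA _ I0)) -(fineK (finA _ (@subDsetl _ _ _))).
case: c {DA cr r0} cA => [s| |]//= cA h1 [h2].
  by rewrite -EFinB lee_fin; rewrite lte_fin in h1; lra.
Qed.

(** The disjoint pieces are split off from [A] one at a time. This is the counting bound behind the
    packing arguments. *)
Lemma sum_caratheodory_le (I : eqType) (s : seq I) (B : I ->
  set T) (A : set T) :
  uniq s -> {in s, forall i, mu.-caratheodory (B i)} ->
  {in s, forall i, B i `<=` A} ->
  {in s &, forall i j, i != j -> B i `&` B j = set0} ->
  \sum_(i <- s) mu (B i) <= mu A.
Proof.
elim: s A => [|i s ih] A /=; first by rewrite big_nil outer_measure_ge0.
move=> /andP[si us] mB BA dB; rewrite big_cons.
rewrite (mB i _ A) ?mem_head//; apply: leeD.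
  by apply: le_outer_measure => x Bx; split=> //; apply: (BA i);
    rewrite ?mem_head.
apply: ih => // [j js|j js x Bx|j k js ks]; last by apply: dB;
  rewrite inE ?js ?ks orbT.
  by apply: mB; rewrite inE js orbT.
split; first by apply: (BA j) => //; rewrite inE js orbT.
move=> Bix; have : (B i `&` B j) x by [].
rewrite dB ?mem_head ?inE ?js ?orbT//.
by apply: contraNneq si => ->.
Qed.

End caratheodory_continuity.

Section borel_lemmas.
Context {R : realType} {X : metricType R}.
Implicit Types A B F G : set X.

Lemma borel_ind (P : set (set X)) : (forall A, closed A -> P A) ->
  (forall A, P A -> P (~` A)) ->
  (forall A : (set X)^nat, (forall n, P (A n)) -> P (\bigcup_n A n)) ->
  forall B, borel B -> P B.
Proof.
move=> Pc PC Pu; apply: smallest_sub.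
  split; first by apply: Pc; exact: closed0.
  - by move=> A PA; rewrite setTD; exact: PC.
  - by move=> A PA; exact: Pu.
move=> A oA /=; rewrite -(setCK A); apply: PC; apply: Pc; exact: open_closedC.
Qed.

Lemma borel_sigma_algebra : sigma_algebra setT (@borel R X).
Proof. exact: smallest_sigma_algebra. Qed.

Lemma open_borel A : open A -> borel A.
Proof. by move=> oA; apply: sub_sigma_algebra. Qed.

Lemma borelC A : borel A -> borel (~` A).
Proof. by case: borel_sigma_algebra => _ h _ /h; rewrite setTD. Qed.

Lemma closed_borel A : closed A -> borel A.
Proof. by move=> cA; rewrite -(setCK A); apply: borelC; apply: open_borel;
  rewrite openC. Qed.

Lemma borel_bigcup (A : (set X)^nat) : (forall n, borel (A n)) ->
  borel (\bigcup_n A n).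
Proof. by case: borel_sigma_algebra => _ _ h; exact: h. Qed.

Lemma borel_bigcap (A : (set X)^nat) : (forall n, borel (A n)) ->
  borel (\bigcap_n A n).
Proof.
move=> bA; rewrite -(setCK (\bigcap_n A n)) setC_bigcap.
by apply: borelC; apply: borel_bigcup => n; exact: borelC.
Qed.

Lemma borel_caratheodory (mu : {outer_measure set X -> \bar R}) :
  (forall F, closed F -> mu.-caratheodory F) ->
  forall B, borel B -> mu.-caratheodory B.
Proof.
move=> mF; apply: borel_ind => //.
- by move=> A; exact: caratheodory_measurable_setC.
- by move=> A; exact: caratheodory_measurable_bigcup.
Qed.

Lemma closedPmdist F : closed F <->
  forall x, ~ F x -> exists2 e : R, (0 < e)%R & forall y, F y ->
    (e <= mdist x y)%R.
Proof.
split=> [cF x Fx|h].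
  have : nbhs x (~` F) by apply: open_nbhs_nbhs; split=> //;
    exact: closed_openC.
  rewrite -metricType_numDomainType.nbhs_nbhs_mdist => -[e /= e0 he].
  by exists e => // y Fy; rewrite leNgt; apply/negP => /he.
rewrite -openC openE => x /= /h[e e0 he].
rewrite /interior -metricType_numDomainType.nbhs_nbhs_mdist.
by exists e => //= y /= ye Fy; have := he _ Fy; rewrite leNgt ye.
Qed.

Lemma closed_cball (x : X) (r : R) : closed (cball x r).
Proof.
apply/closedPmdist => y; rewrite /cball /= => /negP; rewrite -ltNge => ry.
exists (mdist x y - r)%R; first by rewrite subr_gt0.
move=> z xz; have := metric_triangle x z y; rewrite (metric_sym z y); lra.
Qed.

Lemma open_mnbhs (A : set X) (e : R) :
  open [set y | exists2 x, A x & (mdist x y < e)%R].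
Proof.
rewrite openE => y /= [x Ax xy].
rewrite /interior -metricType_numDomainType.nbhs_nbhs_mdist.
exists (e - mdist x y)%R => /=; first by rewrite subr_gt0.
by move=> z /= yz; exists x => //; have := metric_triangle x y z; lra.
Qed.

End borel_lemmas.

(** * Caratheodory's criterion for metric outer measures *)

Section metric_outer_measure.
Context {R : realType} {X : metricType R} (mu : {outer_measure set X ->
  \bar R}).
Hypothesis mu_metric : forall (A B : set X) (e : R), (0 < e)%R ->
  (forall x y, A x -> B y -> (e <= mdist x y)%R) -> mu A + mu B <= mu (A `|` B).

Let far (A F : set X) (n : nat) : set X :=
  [set x | A x /\ forall y, F y -> (n.+1%:R^-1 <= mdist x y)%R].

Let far_nd A F m n : (m <= n)%N -> far A F m `<=` far A F n.
Proof.
move=> mn x [Ax h]; split=> // y Fy; apply: le_trans (h y Fy).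
by rewrite lef_pV2 ?posrE ?ltr0n// ler_nat ltnS.
Qed.

Let ring_ A F n := far A F n.+1 `\` far A F n.

(** A point of the ring is closer to [F] than [1 / (n + 2)], a point of [far A F n] is not closer
    than [1 / (n + 1)]; the triangle inequality separates the two sets by the difference. *)
Let far_ring A F n : mu (far A F n) + mu (ring_ A F n.+1) <= mu (far A F n.+2).
Proof.
apply: (@le_trans _ _ (mu (far A F n `|` ring_ A F n.+1))); last first.
  apply: le_outer_measure => x [|[]//]; apply: far_nd; exact: leqW.
have e0 : (0 < n.+1%:R^-1 - n.+2%:R^-1 :> R)%R.
  by rewrite subr_gt0 ltf_pV2 ?posrE ?ltr0n// ltr_nat.
apply: mu_metric e0 _ => x y [Ax hx] [[Ay hy]].
move=> /not_andP[//|/existsNP[z /not_implyP[Fz /negP]]]; rewrite -ltNge => yz.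
move: (hx z Fz) yz (metric_triangle x y z).
by move: (n.+1%:R^-1)%R (n.+2%:R^-1)%R => a b; lra.
Qed.

Let ring_sum A F n : \sum_(i < n.*2.+2) mu (ring_ A F i) <=
  mu (far A F n.*2.+1) + mu (far A F n.*2.+2).
Proof.
have ringfar m : mu (ring_ A F m) <= mu (far A F m.+1).
  by apply: le_outer_measure => x [].
elim: n => [|n ih]; first by rewrite !big_ord_recr big_ord0 /= add0e leeD.
rewrite doubleS 2!big_ord_recr /=.
apply: (le_trans (leeD2r _ (leeD2r _ ih))).
rewrite -addeA addeACA; apply: leeD; exact: far_ring.
Qed.

(* The sets [far A F n] increase to [A `\` F], and their successive differences
   of the same parity are at positive distance from each other, so that the
   measures of these differences form a convergent series. *)
Lemma metric_outer_caratheodory (F : set X) : closed F -> mu.-caratheodory F.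
Proof.
move=> cF; apply: le_caratheodory_measurable => A.
have [->|Aoo] := eqVneq (mu A) +oo; first by rewrite leey.
have farA n : mu (far A F n) <= mu A by apply: le_outer_measure => x [].
have split_far n : mu (A `&` F) + mu (far A F n) <= mu A.
  apply: (@le_trans _ _ (mu (A `&` F `|` far A F n))); last first.
    by apply: le_outer_measure => x [[]|[]].
  apply: (mu_metric (e := n.+1%:R^-1)); first by rewrite invr_gt0 ltr0n.
  by move=> x y [_ Fx] [_ /(_ x Fx)]; rewrite metric_sym.
have sfin : \sum_(i <oo) mu (ring_ A F i) < +oo.
  apply: (@le_lt_trans _ _ (mu A + mu A)); last first.
    by rewrite lte_add_pinfty// ltey.
  apply: lime_le; first by apply: is_cvg_nneseries => n _ _;
    exact: outer_measure_ge0.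
  apply: nearW => n; rewrite big_mkord.
  apply: le_trans (leeD (farA n.*2.+1) (farA n.*2.+2)).
  apply: le_trans (ring_sum A F n).
  apply: (lee_sum_nneg_ord (fun i => mu (ring_ A F i)) xpredT) => [i _|].
    exact: outer_measure_ge0.
  by rewrite -addnn -!addnS leq_addr.
apply/lee_addgt0Pr => e e0.
have /fine_cvgP[[n1 _ h1] /cvgrPdist_le/(_ e e0)[n2 _ h2]] :=
  nneseries_tail_cvg sfin (fun n _ => outer_measure_ge0 mu (ring_ A F n)).
pose n := maxn n1 n2.
have {h1 h2} tail : \sum_(n <= i <oo) mu (ring_ A F i) <= e%:E.
  rewrite -[leLHS]fineK ?lee_fin; last by apply: h1; exact: leq_maxl.
  have /= := h2 n (leq_maxr _ _); rewrite sub0r normrN.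
  exact/le_trans/ler_norm.
apply: le_trans (leeD (split_far n) tail).
rewrite -addeA leeD2l//.
apply: le_trans (leeD2l _ (outer_measure_sigma_subadditive_tail mu n _)).
apply: le_trans (outer_measureU2 _ _ _).
apply: le_outer_measure => x [Ax Fx].
have [m] : exists m, far A F m x.
  have /closedPmdist/(_ x Fx)[d d0 hd] := cF.
  have [m /ltW md] := exists_invSn_lt d0.
  by exists m; split=> // y Fy; exact: le_trans (hd y Fy).
elim: m => [|m ih] fm; first by left; apply: far_nd fm.
have [/ih//|nfm] := pselect (far A F m x).
have [mn|nm] := ltnP m n; first by left; apply: far_nd fm.
by right; exists m => //=; rewrite ltnNge nm.
Qed.

End metric_outer_measure.

(** * Inner regularity by closed sets *)

Section closed_regularity.
Context {R : realType} {X : metricType R} (nu : {outer_measure set X ->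
  \bar R}).
Hypothesis nuF : forall F : set X, closed F -> nu.-caratheodory F.
Variable Z : set X.
Hypotheses (cZ : closed Z) (Zoo : nu Z < +oo).

(** Approximating [A] and its complement at the same time makes the class visibly stable under
    complements, as an induction over Borel sets requires. *)
Let approx (A : set X) := forall e : R, (0 < e)%R -> exists F G : set X,
  [/\ closed F, closed G, F `<=` A, G `<=` ~` A & nu (Z `\` (F `|` G)) <= e%:E].

Let approxC A : approx A -> approx (~` A).
Proof.
move=> h e /h[F [G [cF cG FA GA le]]]; exists G, F; split => //.
- by rewrite setCK.
- by rewrite setUC.
Qed.

(* [~` A] is the increasing union of the closed sets [G n] below. *)
Let approx_closed A : closed A -> approx A.
Proof.
move=> cA e e0.
pose G n : set X := [set x | forall y, A y -> (n.+1%:R^-1 <= mdist x y)%R].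
have cG n : closed (G n).
  apply/closedPmdist => x /existsNP[y /not_implyP[Ay /negP]];
    rewrite -ltNge => xy.
  exists (n.+1%:R^-1 - mdist x y)%R; first by rewrite subr_gt0.
  move=> z Gz; move: (Gz y Ay) (metric_triangle z x y).
  by rewrite (metric_sym z x); move: (n.+1%:R^-1)%R => a; lra.
have GA n : G n `<=` ~` A.
  by move=> x Gx /Gx; rewrite mdistxx leNgt invr_gt0 ltr0n.
pose D n := Z `\` (A `|` G n).
have niD : nonincreasing_seq D.
  move=> m n mn; apply/subsetPset => x [Zx /not_orP[Ax Gx]];
    split=> // -[//|Gm].
  apply: Gx => y Ay; apply: le_trans (Gm y Ay).
  by rewrite lef_pV2 ?posrE ?ltr0n// ler_nat ltnS.
have [[n De]|/forallNP h] := pselect (exists n, nu (D n) <= e%:E).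
  by exists A, (G n); split.
suff : e%:E <= nu (\bigcap_n D n).
  rewrite (_ : \bigcap_n D n = set0);
    first by rewrite outer_measure0 lee_fin leNgt e0.
  rewrite -subset0 => x Dx; have [Zx /not_orP[Ax _]] := Dx 0%N I.
  have /closedPmdist/(_ x Ax)[d d0 hd] := cA.
  have [n nd] := exists_invSn_lt d0.
  have [_ /not_orP[_]] := Dx n I; apply => y Ay.
  exact: le_trans (ltW nd) (hd y Ay).
apply: caratheodory_bigcap_ge => //.
- move=> n; apply: caratheodory_measurable_setD; first exact: nuF.
  by apply: caratheodory_measurable_setU; exact: nuF.
- by apply: le_lt_trans Zoo; apply: le_outer_measure => x [].
- by move=> n; have := h n => /negP; rewrite -ltNge => /ltW.
Qed.

(** The intersection of the [G n] is closed, but the union of the [F n] need not be. A finite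
    subunion replaces it, chosen by continuity from above. *)
Let approx_bigcup (A : (set X)^nat) :
  (forall n, approx (A n)) -> approx (\bigcup_n A n).
Proof.
move=> hA e e0.
(* Half of [e] pays for the errors of all the [A n]; the other half is left for truncating the
   union. *)
have e2 n : (0 < e / 2 / (2 ^ n.+1)%:R)%R by rewrite !divr_gt0// ltr0n expn_gt0.
have /choice[FG hFG] : forall n, exists FG : set X * set X,
    [/\ closed FG.1, closed FG.2, FG.1 `<=` A n, FG.2 `<=` ~` A n &
        nu (Z `\` (FG.1 `|` FG.2)) <= (e / 2 / (2 ^ n.+1)%:R)%:E].
  by move=> n; have [F [G h]] := hA n _ (e2 n); exists (F, G).
pose F n := (FG n).1; pose G n := (FG n).2.
pose C := \bigcap_n G n; pose U n := \big[setU/set0]_(i < n) F i.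
have cF n : closed (F n) by case: (hFG n).
have cU n : closed (U n) by apply: closed_bigsetU.
have cC : closed C by apply: closed_bigI => n _; case: (hFG n).
have small : nu (Z `\` (\bigcup_n F n `|` C)) <= (e / 2)%:E.
  apply: (@le_trans _ _ (nu (\bigcup_n (Z `\` (F n `|` G n))))).
    apply: le_outer_measure => x [Zx /not_orP[Fx Cx]].
    have /existsNP[n /not_implyP[_ Gx]] := Cx.
    by exists n => //; split=> // -[Fnx|//]; apply: Fx; exists n.
  apply: (le_trans (outer_measure_sigma_subadditive nu _)).
  apply: le_trans (epsilon_trick0 xpredT (ltW (divr_gt0 e0 (@ltr0n R 2)))).
  apply: lee_nneseries => n _; first by move=> _; exact: outer_measure_ge0.
  by case: (hFG n).
pose D n := Z `\` (U n `|` C).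
have UF n : U n `<=` \bigcup_n F n by exact: bigsetU_bigcup.
have niD : nonincreasing_seq D.
  move=> m n mn; apply/subsetPset => x [Zx /not_orP[Ux Cx]];
    split=> // -[Um|//].
  by apply: Ux; move: Um; apply: subset_bigsetU.
have [[n De]|/forallNP h] := pselect (exists n, nu (D n) <= e%:E).
  exists (U n), C; split => //.
  - by apply: (subset_trans (UF n)) => x [i _ Fx]; exists i => //;
    case: (hFG i) => _ _ + _ _; exact.
  - by move=> x Cx [i _]; case: (hFG i) => _ _ _ + _; apply; exact: Cx.
suff : e%:E <= nu (\bigcap_n D n).
  have DC : \bigcap_n D n `<=` Z `\` (\bigcup_n F n `|` C).
    move=> x Dx; have [Zx /not_orP[_ Cx]] := Dx 0%N I;
      split=> // -[[n _ Fx]|//].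
    by have [_ []] := Dx n.+1 I; left; rewrite /U big_ord_recr; right.
  move=> /le_trans /(_ (le_trans (le_outer_measure nu _ _ DC) small)).
  by rewrite lee_fin; lra.
apply: caratheodory_bigcap_ge => //.
- move=> n; apply: caratheodory_measurable_setD; first exact: nuF.
  by apply: caratheodory_measurable_setU; exact: nuF.
- by apply: le_lt_trans Zoo; apply: le_outer_measure => x [].
- by move=> n; have := h n => /negP; rewrite -ltNge => /ltW.
Qed.

Lemma closed_inner_regular (B : set X) (e : R) : borel B -> (0 < e)%R ->
  exists F, [/\ closed F, F `<=` Z `&` B & nu (Z `&` B) <= nu F + e%:E].
Proof.
move=> bB e0.
have /(_ e e0)[F [G [cF cG FB GB le]]] : approx B.
  exact: (borel_ind approx_closed approxC approx_bigcup).
exists (Z `&` F); split; [exact: closedI|exact: setIS|].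
apply: (@le_trans _ _ (nu (Z `&` F `|` Z `\` (F `|` G)))).
  apply: le_outer_measure => x [Zx Bx].
  have [Fx|Fx] := pselect (F x); first by left.
  by right; split=> // -[//|/GB].
by apply: (le_trans (outer_measureU2 _ _ _)); rewrite leeD2l.
Qed.

End closed_regularity.

(** * Hausdorff measures *)

Section diam_lemmas.
Context {R : realType} {X : metricType R}.
Implicit Types A B : set X.

Lemma diam_ge0 A : 0 <= diam A.
Proof. by rewrite /diam le_max lexx. Qed.

Lemma mdist_le_diam A x y : A x -> A y -> (mdist x y)%:E <= diam A.
Proof.
by move=> Ax Ay; rewrite /diam le_max; apply/orP; right;
  apply: ereal_sup_ubound; exists (x, y).
Qed.

Lemma diam_le A (d : \bar R) : 0 <= d ->
  (forall x y, A x -> A y -> (mdist x y)%:E <= d) -> diam A <= d.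
Proof.
move=> d0 h; rewrite /diam ge_max d0 /=;
  apply: ge_ereal_sup => _ [[x y] [/= Ax Ay] <-].
exact: h.
Qed.

Lemma le_diam A B : A `<=` B -> diam A <= diam B.
Proof.
by move=> AB; apply: diam_le (diam_ge0 _) _ => x y /AB Ax /AB;
  exact: mdist_le_diam.
Qed.

Lemma diam0 : diam (set0 : set X) = 0.
Proof. by apply/eqP; rewrite eq_le diam_ge0 andbT; apply: diam_le. Qed.

Lemma diam_closure A : diam (closure A) = diam A.
Proof.
apply/eqP; rewrite eq_le; apply/andP; split; last exact/le_diam/subset_closure.
apply: diam_le (diam_ge0 _) _ => x y Ax Ay; apply/lee_addgt0Pr => e e0.
have near z : closure A z -> exists2 z', A z' & (mdist z z' < e / 2)%R.
  move=> /(_ (ball z (e / 2))) []; first by apply: nbhsx_ballx;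
    rewrite divr_gt0.
  by move=> z' [Az']; rewrite ballEmdist => ?; exists z'.
have [x' Ax' xx'] := near x Ax; have [y' Ay' yy'] := near y Ay.
apply: le_trans (leeD2r _ (mdist_le_diam Ax' Ay')).
rewrite -EFinD lee_fin; have := metric_triangle x x' y.
by have := metric_triangle x' y' y; rewrite (metric_sym y' y); lra.
Qed.

Lemma diam_sub_cball A x : A x ->
  A `<=` cball x (fine (diam A)) \/ diam A = +oo.
Proof.
move=> Ax; have [->|dA] := eqVneq (diam A) +oo; [by right|left] => y Ay.
rewrite /cball /= -lee_fin fineK ?mdist_le_diam//.
by rewrite ge0_fin_numE ?diam_ge0// ltey.
Qed.

Lemma diam_cball (x : X) (r : R) : (0 <= r)%R -> diam (cball x r) <= (2 * r)%:E.
Proof.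
move=> r0; apply: diam_le; first by rewrite lee_fin; lra.
move=> y z; rewrite /cball /= lee_fin => xy xz.
by have := metric_triangle y x z; rewrite (metric_sym y x); lra.
Qed.

End diam_lemmas.

Section hausdorff.
Context {R : realType} {X : metricType R} (q : R).
Hypothesis q0 : (0 < q)%R.
Implicit Types A B : set X.

Lemma le_diamX A B : A `<=` B -> diam A `^ q <= diam B `^ q.
Proof.
have dT C : (diam C : \bar R) \in `[0, +oo] by rewrite in_itv /= diam_ge0 leey.
by move=> /le_diam; apply: gt0_ler_poweR => //; exact: ltW.
Qed.

Lemma diamX0 : diam (set0 : set X) `^ q = 0.
Proof. by rewrite diam0 poweR0r// gt_eqF. Qed.

Lemma hausdorff_content_le (delta : R) A (U : (set X)^nat) :
  A `<=` \bigcup_n U n -> (forall n, diam (U n) <= delta%:E) ->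
  hausdorff_content q delta A <= \sum_(0 <= n <oo) diam (U n) `^ q.
Proof. by move=> AU dU; apply: ereal_inf_lbound; exists U. Qed.

Lemma hausdorff_content_ge (delta : R) A (c : \bar R) :
  (forall U : (set X)^nat, A `<=` \bigcup_n U n ->
    (forall n, diam (U n) <= delta%:E) ->
    c <= \sum_(0 <= n <oo) diam (U n) `^ q) ->
  c <= hausdorff_content q delta A.
Proof. by move=> h; apply: le_ereal_inf_tmp => _ [U [AU dU] <-]; exact: h. Qed.

Lemma hausdorff_content_ge0 delta A : 0 <= hausdorff_content q delta A.
Proof.
apply: hausdorff_content_ge => U _ _; apply: nneseries_ge0 => n _ _.
exact: poweR_ge0.
Qed.

Lemma hausdorff_content_adherent delta A (e : R) : (0 < e)%R ->
  hausdorff_content q delta A < +oo ->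
  exists U : (set X)^nat, [/\ A `<=` \bigcup_n U n,
    (forall n, diam (U n) <= delta%:E) &
    \sum_(0 <= n <oo) diam (U n) `^ q <= hausdorff_content q delta A + e%:E].
Proof.
move=> e0 coo; have cfin : hausdorff_content q delta A \is a fin_num.
  by rewrite ge0_fin_numE// hausdorff_content_ge0.
have [_ [U [AU dU] <-] /ltW] := lb_ereal_inf_adherent e0 cfin.
by exists U.
Qed.

Lemma le_hausdorff_content delta delta' A B : A `<=` B -> (delta' <= delta)%R ->
  hausdorff_content q delta A <= hausdorff_content q delta' B.
Proof.
move=> AB dd; apply: hausdorff_content_ge => U BU dU.
apply: hausdorff_content_le; first exact: subset_trans BU.
by move=> n; rewrite (le_trans (dU n))// lee_fin.
Qed.

Lemma hausdorff_content0 (delta : R) : (0 <= delta)%R ->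
  hausdorff_content q delta (set0 : set X) = 0.
Proof.
move=> d0; apply/eqP; rewrite eq_le hausdorff_content_ge0 andbT.
apply: (le_trans (@hausdorff_content_le _ _ (fun=> set0) _ _)) => //.
  by move=> n; rewrite diam0 lee_fin.
by rewrite eseries0// => n _ _; exact: diamX0.
Qed.

Lemma hausdorff_content_sigma_subadditive delta :
  sigma_subadditive (@hausdorff_content R X q delta).
Proof.
move=> A; have [[i ioo]|/forallNP Aoo] :=
    pselect (exists i, hausdorff_content q delta (A i) = +oo).
  rewrite (eseries_pinfty _ _ ioo) ?leey// => n _.
  by rewrite -ltNye (lt_le_trans _ (hausdorff_content_ge0 _ _)).
apply/lee_addgt0Pr => e e0.
apply: le_trans (epsilon_trick xpredT (fun n =>
  hausdorff_content_ge0 delta (A n)) (ltW e0)).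
have e2 n : (0 < e / (2 ^ n.+1)%:R)%R by rewrite divr_gt0// ltr0n expn_gt0.
have coo n : hausdorff_content q delta (A n) < +oo by rewrite ltey; exact/eqP.
have /choice[U hU] n := hausdorff_content_adherent (e2 n) (coo n).
(* The doubly indexed cover is enumerated along a bijection of [nat] with [nat * nat]; unordered
   sums then allow the rearrangement. *)
have /card_esym/ppcard_eqP[f] := card_nat2.
pose g (p : nat * nat) := diam (U p.1 p.2) `^ q.
have g0 p : 0 <= g p by exact: poweR_ge0.
apply: (@le_trans _ _ (\sum_(0 <= n <oo) g (f n))).
  apply: hausdorff_content_le => [x [i _ Aix]|n]; last by case: (hU (f n).1).
  have [/(_ x Aix)[j _ Ux] _ _] := hU i.
  by exists (f^-1%FUN (i, j)) => //=; rewrite invK ?inE.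
apply: (@le_trans _ _ (\sum_(0 <= i <oo) \sum_(0 <= j <oo) g (i, j)));
  last first.
  apply: lee_nneseries => [n _ _|n _]; first by apply: nneseries_ge0.
  by case: (hU n).
rewrite nneseries_esumT// -(@reindex_esum R _ _ setT setT f g);
  last exact: (@bij _ _ _ _ f).
rewrite (eq_eseriesr (fun i _ => nneseries_esumT (fun j => g0 (i, j)))).
rewrite nneseries_esumT; last by move=> n; apply: esum_ge0.
rewrite (@esum_esum R nat nat setT (fun=> setT) (fun i j => g (i, j)))//.
rewrite (_ : setT `*`` _ = setT); last by apply/seteqP; split.
by apply: le_esum => -[].
Qed.

(** A set of diameter at most [delta] cannot meet both [A] and [B], so every admissible cover splits
    into a cover of each. *)
Lemma hausdorff_contentU delta A B (e : R) : (delta < e)%R ->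
  (forall x y, A x -> B y -> (e <= mdist x y)%R) ->
  hausdorff_content q delta A + hausdorff_content q delta B <=
  hausdorff_content q delta (A `|` B).
Proof.
move=> de hAB; apply: hausdorff_content_ge => U ABU dU.
have sub C n : diam (U n `&` C) <= delta%:E.
  by apply: le_trans (dU n); apply: le_diam => x [].
apply: (@le_trans _ _ (\sum_(0 <= n <oo) diam (U n `&` A) `^ q +
                       \sum_(0 <= n <oo) diam (U n `&` B) `^ q)).
  apply: leeD; apply: hausdorff_content_le => //.
  - by move=> x Ax; have [n _ Ux] := ABU x (or_introl Ax); exists n.
  - by move=> x Bx; have [n _ Ux] := ABU x (or_intror Bx); exists n.
rewrite -nneseriesD; [|by move=> *; exact: poweR_ge0..].
apply: lee_nneseries => [n _ _|n _]; first by rewrite adde_ge0 ?poweR_ge0.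
have [/eqP AU|/set0P[x [Ux Ax]]] := eqVneq (U n `&` A) set0.
  by rewrite (eqP AU) diamX0 add0e le_diamX// => x [].
rewrite (_ : U n `&` B = set0);
  first by rewrite diamX0 adde0 le_diamX// => y [].
rewrite -subset0 => y [Uy By]; have := le_trans (mdist_le_diam Ux Uy) (dU n).
by rewrite lee_fin leNgt (lt_le_trans de)// hAB.
Qed.

Lemma hausdorff_content_le_measure (delta : R) A : (0 < delta)%R ->
  hausdorff_content q delta A <= hausdorff_measure q A.
Proof. by move=> d0; apply: ereal_sup_ubound; exists delta. Qed.

Lemma hausdorff_measure_le A (c : \bar R) :
  (forall delta : R, (0 < delta)%R -> hausdorff_content q delta A <= c) ->
  hausdorff_measure q A <= c.
Proof. by move=> h; apply: ge_ereal_sup => _ [d d0 <-]; exact: h. Qed.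

Lemma hausdorff_measure_ge0 A : 0 <= hausdorff_measure q A.
Proof.
exact: le_trans (hausdorff_content_ge0 1 A) (hausdorff_content_le_measure A
  ltr01).
Qed.

Lemma hausdorff_measure0 : hausdorff_measure q (set0 : set X) = 0.
Proof.
apply/eqP; rewrite eq_le hausdorff_measure_ge0 andbT.
by apply: hausdorff_measure_le => d d0; rewrite hausdorff_content0// ltW.
Qed.

Lemma le_hausdorff_measure A B : A `<=` B ->
  hausdorff_measure q A <= hausdorff_measure q B.
Proof.
move=> AB; apply: hausdorff_measure_le => d d0.
exact: le_trans (le_hausdorff_content AB (lexx d))
  (hausdorff_content_le_measure B d0).
Qed.

Lemma hausdorff_measure_sigma_subadditive :
  sigma_subadditive (@hausdorff_measure R X q).
Proof.
move=> A; apply: hausdorff_measure_le => d d0.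
apply: le_trans (hausdorff_content_sigma_subadditive d A) _.
apply: lee_nneseries => [n _ _|n _]; first exact: hausdorff_content_ge0.
exact: hausdorff_content_le_measure.
Qed.

Definition hausdorff_outer : {outer_measure set X -> \bar R} :=
  HB.pack (@hausdorff_measure R X q)
    (isOuterMeasure.Build R X (@hausdorff_measure R X q)
      hausdorff_measure0 hausdorff_measure_ge0 le_hausdorff_measure
      hausdorff_measure_sigma_subadditive).

Lemma hausdorff_metric (A B : set X) (e : R) : (0 < e)%R ->
  (forall x y, A x -> B y -> (e <= mdist x y)%R) ->
  hausdorff_outer A + hausdorff_outer B <= hausdorff_outer (A `|` B).
Proof.
move=> e0 hAB.
(* Independent scales [d] and [d'] allow the suprema defining the two measures to be taken one after
   the other. *)
have key d d' : (0 < d)%R -> (0 < d')%R ->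
    hausdorff_content q d A + hausdorff_content q d' B <= hausdorff_outer (A
      `|` B).
  move=> d0 d'0; pose m := Num.min (Num.min d d') (e / 2)%R.
  have m0 : (0 < m)%R by rewrite !lt_min d0 d'0 divr_gt0.
  apply: le_trans (hausdorff_content_le_measure _ m0).
  apply: le_trans (hausdorff_contentU _ hAB); last first.
    by rewrite gt_min; apply/orP; right; lra.
  apply: leeD; apply: le_hausdorff_content => //; rewrite !ge_min lexx ?orbT//.
have [oo|/eqP] := eqVneq (hausdorff_outer (A `|` B)) +oo;
  first by rewrite oo leey.
move=> /eqP oo.
have fin (C : set X) : C `<=` A `|` B -> hausdorff_outer C \is a fin_num.
  move=> CAB; rewrite ge0_fin_numE ?outer_measure_ge0//.
  by rewrite (le_lt_trans (le_outer_measure hausdorff_outer _ _ CAB))// ltey.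
rewrite -leeBrDr; last by apply: fin => x; right.
apply: hausdorff_measure_le => d d0.
rewrite leeBrDr; last by apply: fin => x; right.
rewrite addeC -leeBrDr; last first.
  rewrite ge0_fin_numE ?hausdorff_content_ge0//.
  apply: le_lt_trans (hausdorff_content_le_measure A d0) _.
  by rewrite -ge0_fin_numE ?hausdorff_measure_ge0//; apply: fin => x; left.
apply: hausdorff_measure_le => d' d'0.
rewrite leeBrDr; last first.
  rewrite ge0_fin_numE ?hausdorff_content_ge0//.
  apply: le_lt_trans (hausdorff_content_le_measure A d0) _.
  by rewrite -ge0_fin_numE ?hausdorff_measure_ge0//; apply: fin => x; left.
by rewrite addeC key.
Qed.

Lemma hausdorff_borel_regular : borel_regular hausdorff_outer.
Proof.
split=> [|A].
  by apply: borel_caratheodory; apply: metric_outer_caratheodory;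
    exact: hausdorff_metric.
have [Aoo|Aoo] := eqVneq (hausdorff_measure q A) +oo.
  exists setT; split=> //; first by apply: open_borel; exact: openT.
  apply/eqP; rewrite eq_le /= Aoo leey /= -Aoo; exact: le_hausdorff_measure.
pose d n : R := (n.+1%:R^-1)%R.
have d0 n : (0 < d n)%R by rewrite invr_gt0 ltr0n.
have coo n : hausdorff_content q (d n) A < +oo.
  by apply: le_lt_trans (hausdorff_content_le_measure A (d0 n)) _; rewrite ltey.
have /choice[U hU] n := hausdorff_content_adherent (d0 n) (coo n).
(* Taking closures makes the nearly optimal covers Borel without changing any diameter. *)
exists (\bigcap_n \bigcup_k closure (U n k)); split.
- apply: borel_bigcap => n; apply: borel_bigcup => k; apply: closed_borel;
  exact: closed_closure.
- move=> x Ax n _; have [/(_ x Ax)[k _ Ux] _ _] := hU n.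
  by exists k => //; exact: subset_closure.
apply/eqP; rewrite eq_le; apply/andP; split; last first.
  apply: le_hausdorff_measure => x Ax n _; have [/(_ x Ax)[k _ Ux] _ _] := hU n.
  by exists k => //; exact: subset_closure.
apply: hausdorff_measure_le => delta delta0; apply/lee_addgt0Pr => e e0.
have [n] : exists n, (d n < Num.min delta e)%R by apply: exists_invSn_lt;
  rewrite lt_min delta0.
rewrite lt_min => /andP[/ltW ndelta /ltW ne].
apply: (@le_trans _ _ (hausdorff_content q (d n) (\bigcup_k closure (U n k)))).
  apply: le_hausdorff_content => //; exact: bigcap_inf.
have [_ dU sU] := hU n.
apply: le_trans (hausdorff_content_le (U :=
  fun k => closure (U n k)) _ _) _ => //.
  by move=> k; rewrite diam_closure.
under eq_eseriesr do rewrite diam_closure.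
apply: (le_trans sU); apply: leeD; last by rewrite lee_fin.
exact: hausdorff_content_le_measure.
Qed.

End hausdorff.

(** * Measures comparable to a power of the radius *)

Section nets.
Context {R : realType} {Y : metricType R}.

(** A separated list of largest size is a net, since a point far from it could be added. The bound
    [N] provides a largest size without any compactness. *)
Lemma exists_net (F : set Y) (eps : R) (N : nat) : (0 <= eps)%R ->
  (forall s : seq Y, uniq s -> {in s, forall x, F x} ->
    {in s &, forall x y, x != y -> (eps < mdist x y)%R} -> (size s <= N)%N) ->
  exists s : seq Y, [/\ uniq s, {in s, forall x, F x},
    {in s &, forall x y, x != y -> (eps < mdist x y)%R} &
    forall y, F y -> exists2 x, x \in s & (mdist x y <= eps)%R].
Proof.
move=> eps0 bound.
pose P n := `[< exists s : seq Y, [/\ uniq s, {in s, forall x, F x},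
    {in s &, forall x y, x != y -> (eps < mdist x y)%R} & size s = n] >].
have exP : exists n, P n by exists 0%N; apply/asboolP; exists [::]; split.
have leP n : P n -> (n <= N)%N by move=> /asboolP[s [us sF sep <-]];
  exact: bound.
case: (ex_maxnP exP leP) => n /asboolP[s [us sF sep sn]] max.
exists s; split=> // y Fy; apply: contrapT => /forall2NP far.
have {}far x : x \in s -> (eps < mdist x y)%R.
  by move=> xs; have [//|/negP] := far x; rewrite -ltNge.
have ys : y \notin s by apply/negP => /far; rewrite mdistxx ltNge eps0.
suff /max : P n.+1 by rewrite ltnn.
apply/asboolP; exists (y :: s); split=> /=; rewrite ?ys ?sn//.
  by move=> x; rewrite inE => /orP[/eqP->//|/sF].
move=> x z; rewrite !inE => /orP[/eqP->|xs] /orP[/eqP->|zs] xz.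
- by rewrite eqxx in xz.
- by rewrite metric_sym far.
- exact: far.
- exact: sep.
Qed.

Lemma hausdorff_content_net (q : R) (F : set Y) (eps : R) (s : seq Y) :
  (0 < q)%R -> (0 <= eps)%R ->
  (forall y, F y -> exists2 x, x \in s & (mdist x y <= eps)%R) ->
  hausdorff_content q (2 * eps) F <= ((2 * eps) `^ q *+ size s)%:E.
Proof.
move=> q0 eps0 net; case: s net => [|y0 s'] net.
  rewrite (_ : F = set0) ?hausdorff_content0 ?lee_fin ?mulr_ge0//.
  by rewrite -subset0 => y /net[].
move: (y0 :: s') net => s net.
(* The finite cover is padded with empty sets, which contribute 0 because [q > 0]. *)
pose U n := if (n < size s)%N then cball (nth y0 s n) eps else set0.
have dU n : diam (U n) <= (2 * eps)%:E.
  rewrite /U; case: ifP => _; first exact: diam_cball.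
  by rewrite diam0 lee_fin mulr_ge0.
apply: (@le_trans _ _ (\sum_(0 <= n <oo) diam (U n) `^ q)).
  apply: hausdorff_content_le => // y /net[x xs xy].
  by exists (index x s) => //; rewrite /U index_mem xs /cball /= nth_index.
rewrite (nneseries_split 0 (size s)); last by move=> *; exact: poweR_ge0.
rewrite [X in _ + X]eseries0 ?adde0; last first.
  by move=> n; rewrite add0n => sn _; rewrite /U ltnNge sn /= diamX0.
rewrite add0n big_mkord -[size s in leRHS]card_ord -sumr_const -sumEFin.
apply: lee_sum => i _; rewrite -poweR_EFin; apply: gt0_ler_poweR => //.
- exact: ltW.
- by rewrite in_itv /= diam_ge0 leey.
- by rewrite in_itv /= leey lee_fin mulr_ge0.
Qed.

End nets.

(** * The mass distribution principle and its converse *)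

Section mass_distribution.
Context {R : realType} {Y : metricType R} (mu : {outer_measure set Y ->
  \bar R}).
Variables (q K : R) (a b : Y).
Hypotheses (q0 : (0 < q)%R) (K1 : (1 <= K)%R) (ab : a <> b).
Hypothesis mu_cara : forall F : set Y, closed F -> mu.-caratheodory F.
Hypothesis mu_up : forall (y : Y) (r : R), (0 < r)%R ->
  mu (cball y r) <= (K * r `^ q)%:E.
Hypothesis mu_low : forall (y : Y) (r : R), (0 < r)%R ->
  r%:E <= diam [set: Y] -> (K^-1 * r `^ q)%:E <= mu (cball y r).

Let K0 : (0 < K)%R. Proof. by rewrite (lt_le_trans ltr01). Qed.
Let H : {outer_measure set Y -> \bar R} := @hausdorff_outer R Y q q0.

Lemma mass_le_diam (U : set Y) : diam U < +oo -> mu U <= K%:E * diam U `^ q.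
Proof.
move=> dU; have [->|/set0P[x Ux]] := eqVneq U set0.
  by rewrite outer_measure0 mule_ge0 ?poweR_ge0// lee_fin ltW.
have dfin : diam U \is a fin_num by rewrite ge0_fin_numE// diam_ge0.
have [Usub|oo] := diam_sub_cball Ux; last by rewrite oo in dU.
apply: le_trans (le_outer_measure mu _ _ Usub) _.
rewrite -[in leRHS](fineK dfin) poweR_EFin -EFinM.
(* [mu_up] asks for a positive radius. When the diameter is 0, the radius with [K * r ^ q = e] gives
   the bound [e] for every [e > 0]. *)
have := diam_ge0 U; rewrite -(fineK dfin) lee_fin le_eqVlt => /orP[/eqP d0|];
  last exact: mu_up.
rewrite -d0 powR0 ?gt_eqF// mulr0; apply/lee_addgt0Pr => e e0; rewrite add0e.
have r0 : (0 < (e / K) `^ q^-1)%R by apply: powR_gt0; rewrite divr_gt0.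
apply: (@le_trans _ _ (mu (cball x ((e / K) `^ q^-1)))).
  by apply: le_outer_measure => y; rewrite /cball /= => /le_trans; apply;
    exact: ltW.
apply: (le_trans (mu_up x r0)).
have eK0 : (0 <= e / K)%R by rewrite divr_ge0 ?ltW.
rewrite lee_fin -powRrM mulVf ?gt_eqF//.
by rewrite powRr1// mulrC divfK ?gt_eqF.
Qed.

Lemma mass_le_hausdorff (A : set Y) : mu A <= K%:E * hausdorff_measure q A.
Proof.
rewrite -lee_pdivrMl//.
(* The scale 1 is arbitrary: it only makes the covering sets have finite diameter. *)
apply: le_trans (hausdorff_content_le_measure q A ltr01).
apply: hausdorff_content_ge => U AU dU; rewrite lee_pdivrMl//.
apply: le_trans (le_outer_measure mu _ _ AU) _.
apply: le_trans (outer_measure_sigma_subadditive mu _) _.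
rewrite -nneseriesZl; last by move=> n _; exact: poweR_ge0.
apply: lee_nneseries => [n _ _|n _]; first exact: outer_measure_ge0.
by apply: mass_le_diam; apply: le_lt_trans (dU n) _; rewrite ltry.
Qed.

Let nbhd (F : set Y) (e : R) := [set y | exists2 x, F x & (mdist x y < e)%R].

(* The balls of radius [eps / 3] centered at a maximal [eps]-separated subset of
   [F] are disjoint, those of radius [eps] cover [F]. *)
Lemma hausdorff_content_le_mass (F : set Y) (eps : R) : (0 < eps)%R ->
  eps%:E <= diam [set: Y] -> mu (nbhd F eps) < +oo ->
  hausdorff_content q (2 * eps) F <= (K * 6 `^ q)%:E * mu (nbhd F eps).
Proof.
move=> eps0 epsd fin.
pose c := (K^-1 * (eps / 3) `^ q)%R.
have c0 : (0 < c)%R by rewrite mulr_gt0 ?invr_gt0// powR_gt0; lra.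
pose m := fine (mu (nbhd F eps)).
have mE : mu (nbhd F eps) = m%:E by rewrite fineK// ge0_fin_numE
  ?outer_measure_ge0.
have count (s : seq Y) : uniq s -> {in s, forall x, F x} ->
    {in s &, forall x y, x != y -> (eps < mdist x y)%R} -> (c *+ size s <= m)%R.
  move=> us sF sep; rewrite -lee_fin -mE.
  apply: le_trans (sum_caratheodory_le (B :=
    fun x => cball x (eps / 3)) us _ _ _).
  - rewrite -iter_addr_0 -count_predT -big_const_seq -sumEFin big_seq
    [leRHS]big_seq.
    apply: lee_sum => x xs; apply: mu_low; first by lra.
    by apply: le_trans epsd; rewrite lee_fin; lra.
  - by move=> x _; apply: mu_cara; exact: closed_cball.
  - move=> x xs y; rewrite /cball /= => xy; exists x; [exact: sF|lra].
  - move=> x y xs ys /(sep x y xs ys) xy; rewrite -subset0 => z [];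
    rewrite /cball /=.
    by have := metric_triangle x z y; rewrite (metric_sym z y); lra.
have m0 : (0 <= m)%R by rewrite fine_ge0// outer_measure_ge0.
have [|s [us sF sep net]] :=
  @exists_net _ _ F eps (Num.bound (m / c)) (ltW eps0).
  move=> s us sF sep; have := count s us sF sep.
  rewrite -mulr_natr mulrC -ler_pdivlMr// =>
    /le_lt_trans/(_ (archi_boundP (divr_ge0 m0 (ltW c0)))).
  by rewrite ltr_nat => /ltnW.
apply: le_trans (hausdorff_content_net q0 (ltW eps0) net) _.
rewrite mE -EFinM lee_fin.
(* The factor 6 is the ratio of [2 * eps], which bounds the diameter of the covering balls, to the
   radius [eps / 3] of the packed ones. *)
have -> : ((2 * eps) `^ q = K * 6 `^ q * c)%R.
  rewrite /c mulrACA mulfV ?gt_eqF// mul1r -powRM; [congr (_ `^ _)%R;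
    lra|lra|lra].
rewrite -mulrnAr ler_pM2l ?count// mulr_gt0// powR_gt0//; lra.
Qed.

(** The content is bounded by the mass of ever smaller neighborhoods of [F]. They shrink to [F]
    because it is closed, and their masses are finite because it is bounded, so continuity from
    above applies. *)
Lemma hausdorff_le_mass (F : set Y) (y0 : Y) (r0 : R) : closed F ->
  (0 < r0)%R ->
  F `<=` cball y0 r0 -> hausdorff_measure q F <= (K * 6 `^ q)%:E * mu F.
Proof.
move=> cF r00 Fr; apply: hausdorff_measure_le => delta delta0.
have C0 : (0 < K * 6 `^ q)%R by rewrite mulr_gt0// powR_gt0; lra.
rewrite -lee_pdivrMl//.
have dab : (0 < mdist a b)%R by rewrite mdist_gt0; exact/eqP.
(* The first bound keeps the covering balls below the scale [delta]; the second keeps the radii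
   below the diameter of [Y], as [mu_low] requires. *)
have [n0] : exists n, (n.+1%:R^-1 < Num.min (delta / 2) (mdist a b))%R.
  by apply: exists_invSn_lt; rewrite lt_min dab divr_gt0.
rewrite lt_min => /andP[n0d n0ab].
pose e n : R := ((n0 + n).+1%:R^-1)%R.
have e0 n : (0 < e n)%R by rewrite invr_gt0 ltr0n.
have en0 n : (e n <= n0.+1%:R^-1)%R by rewrite lef_pV2 ?posrE ?ltr0n// ler_nat
  ltnS leq_addr.
have eS m n : (m <= n)%N -> (e n <= e m)%R.
  by move=> mn; rewrite lef_pV2 ?posrE ?ltr0n// ler_nat ltnS leq_add2l.
have fin n : mu (nbhd F (e n)) < +oo.
  apply: (@le_lt_trans _ _ (mu (cball y0 (r0 + e n)))).
    apply: le_outer_measure => y [x /Fr]; rewrite /cball /= => y0x xy.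
    by have := metric_triangle y0 x y; lra.
  by apply: le_lt_trans (mu_up _ _) (ltry _); rewrite addr_gt0.
apply: (@le_trans _ _ (mu (\bigcap_n nbhd F (e n)))); last first.
  apply: le_outer_measure => y Fy; apply: contrapT.
  move=> nFy; have [/(_ cF y nFy)[d d0 hd] _] := closedPmdist F.
  have [n nd] := exists_invSn_lt d0.
  have [x Fx] := Fy n I; rewrite metric_sym => yx.
  have := hd x Fx; rewrite leNgt (lt_trans yx)// (le_lt_trans _ nd)//.
  by rewrite lef_pV2 ?posrE ?ltr0n// ler_nat ltnS leq_addl.
apply: caratheodory_bigcap_ge => //.
- move=> n; rewrite -(setCK (nbhd F (e n)));
  apply: caratheodory_measurable_setC.
  by apply: mu_cara; apply: open_closedC; exact: open_mnbhs.
- move=> m n mn; apply/subsetPset => y [x Fx xy]; exists x => //.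
  exact: lt_le_trans xy (eS _ _ mn).
- move=> n; rewrite lee_pdivrMl//.
  apply: le_trans (hausdorff_content_le_mass (e0 n) _ (fin n)).
    apply: le_hausdorff_content => //; move: (en0 n) n0d.
    by move: (e n) (n0.+1%:R^-1)%R => u v; lra.
  apply: le_trans (mdist_le_diam (x := a) (y := b) I I); rewrite lee_fin.
  by apply: le_trans (en0 n) (ltW n0ab).
Qed.

Lemma mass_ahlfors : ahlfors_regular q Y.
Proof.
have K61 : (1 <= 6 `^ q)%R.
  by rewrite -[leLHS](powRr0 6%R) ler_powR// ?ltW//; lra.
exists (K * K * 6 `^ q)%R => [|y r r0 rd].
  by rewrite (le_trans K1)// -mulrA ler_peMr ?(ltW K0)// (le_trans K1)//
    ler_peMr// ltW.
apply/andP; split.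
  apply: (@le_trans _ _ ((K * K)^-1 * r `^ q)%:E).
    rewrite lee_fin ler_wpM2r ?powR_ge0// lef_pV2 ?posrE ?mulr_gt0 ?powR_gt0//.
    by rewrite ler_peMr// mulr_ge0// ltW.
  rewrite invfM -mulrA EFinM lee_pdivrMl//.
  exact: le_trans (mu_low y r0 rd) (mass_le_hausdorff _).
apply: le_trans (hausdorff_le_mass (@closed_cball _ _ y r) r0 (@subset_refl _
  _)) _.
have C0 : (0 < K * 6 `^ q)%R by rewrite mulr_gt0// powR_gt0; lra.
rewrite (_ : (K * K * 6 `^ q * r `^ q)%R = (K * 6 `^ q * (K * r `^ q))%R);
  last by ring.
by rewrite EFinM; apply: lee_wpmul2l (mu_up _ r0); rewrite lee_fin ltW.
Qed.

(** On each ball of a countable exhaustion, [B] is exhausted up to [e] in [H]-measure by closed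
    subsets. These are [mu]-null, hence [H]-null by [hausdorff_le_mass]. *)
Lemma hausdorff_null (B : set Y) : borel B -> mu B = 0 ->
  hausdorff_measure q B = 0.
Proof.
move=> bB B0; have null n : H (cball a n.+1%:R `&` B) = 0.
  have Hcara F : closed F -> H.-caratheodory F.
    by move=> /closed_borel;
      case: (hausdorff_borel_regular (X := Y) q0) => + _; apply.
  have n0 : (0 < n.+1%:R :> R)%R by rewrite ltr0n.
  have fin : H (cball a n.+1%:R) < +oo.
    apply: le_lt_trans (hausdorff_le_mass (@closed_cball _ _ a _) n0
      (@subset_refl _ _)) _.
    apply: (@le_lt_trans _ _ ((K * 6 `^ q)%:E * (K * n.+1%:R `^ q)%:E));
      last by rewrite -EFinM ltry.
    apply: lee_wpmul2l (mu_up _ n0); rewrite lee_fin mulr_ge0 ?powR_ge0//.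
    exact: ltW.
  apply/eqP; rewrite eq_le outer_measure_ge0 andbT; apply/lee_addgt0Pr => e e0.
  have [F [cF FB le]] := closed_inner_regular Hcara (@closed_cball _ _ a _) fin
    bB e0.
  apply: (le_trans le); rewrite leeD2r//.
  have Fn : F `<=` cball a n.+1%:R by move=> x /FB[].
  apply: le_trans (hausdorff_le_mass cF n0 Fn) _.
  have -> : mu F = 0; last by rewrite mule0.
  apply/eqP; rewrite eq_le outer_measure_ge0 andbT -B0.
  by apply: le_outer_measure => x /FB[].
apply/eqP; rewrite eq_le hausdorff_measure_ge0 andbT.
apply: (@le_trans _ _ (H (\bigcup_n (cball a n.+1%:R `&` B)))).
  apply: le_outer_measure => x Bx; exists (Num.truncn (mdist a x)) => //;
    split=> //.
  by rewrite /cball /= ltW// truncnS_gt.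
apply: le_trans (outer_measure_sigma_subadditive H _) _.
by rewrite eseries0// => n _ _; exact: null.
Qed.

End mass_distribution.

(** * Pulling back the Hausdorff measure *)

Section pullback.
Context {R : realType} {X Y : Type} (nu : {outer_measure set Y ->
  \bar R}) (f : X -> Y).

Let pb (A : set X) : \bar R := nu (f @` A).

Let pb0 : pb set0 = 0. Proof. by rewrite /pb image_set0 outer_measure0. Qed.

Let pb_ge0 A : 0 <= pb A. Proof. exact: outer_measure_ge0. Qed.

Let le_pb : {homo pb : A B / A `<=` B >-> A <= B}.
Proof. by move=> A B AB; apply: le_outer_measure; exact: image_subset. Qed.

Let pb_sigma : sigma_subadditive pb.
Proof.
move=> A; rewrite /pb image_bigcup; exact: outer_measure_sigma_subadditive.
Qed.

Definition pullback_outer : {outer_measure set X -> \bar R} :=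
  HB.pack pb (isOuterMeasure.Build R X pb pb0 pb_ge0 le_pb pb_sigma).

Lemma pullback_outerE A : pullback_outer A = nu (f @` A).
Proof. by []. Qed.

End pullback.

Lemma borel_preimage {R : realType} {X Y : metricType R} (f : X ->
  Y) (B : set Y) :
  continuous f -> borel B -> borel (f @^-1` B).
Proof.
move=> cf; apply: (borel_ind (P :=
  fun B => borel (f @^-1` B))) => [A cA|A|A bA].
- by apply: closed_borel; apply: preimage_closed.
- by rewrite preimage_setC; exact: borelC.
- by rewrite preimage_bigcup; exact: borel_bigcup.
Qed.

Section pullback_borel.
Context {R : realType} {X Y : metricType R}.

Lemma image_cancel (f : X -> Y) (g : Y -> X) (A : set X) :
  cancel f g -> cancel g f -> f @` A = g @^-1` A.
Proof.
move=> fg gf; apply/seteqP; split => y; first by move=> [x Ax <-];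
  rewrite /= fg.
by move=> Agy; exists (g y).
Qed.

Lemma pullback_borel_regular (nu : {outer_measure set Y -> \bar R}) (f : X ->
  Y) :
  homeomorphism f -> borel_regular nu -> borel_regular (pullback_outer nu f).
Proof.
move=> [g [fg gf cf cg]] [nuB nuR]; split=> [B bB A|A].
  have := nuB _ (borel_preimage cg bB) (g @^-1` A).
  by rewrite !pullback_outerE !(image_cancel _ fg gf) !preimage_setI
    preimage_setC.
have [B [bB AB BA]] := nuR (f @` A).
exists (f @^-1` B); split; first exact: borel_preimage.
- by move=> x Ax; apply: AB; exists x.
rewrite !pullback_outerE -BA; congr (nu _); rewrite (image_cancel _ fg gf).
by apply/seteqP; split=> y /=; rewrite gf.
Qed.

End pullback_borel.

Section quasisymmetric_pullback.
Context {R : realType} {X Y : metricType R}.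

(* Only the boundedness of [eta] on compact sets is used. *)
Lemma quasisymmetric_weak (f : X -> Y) (T : R) : quasisymmetric f ->
  (0 <= T)%R ->
  exists2 M : R, (1 <= M)%R & forall x y z, x <> z ->
    (mdist x y <= T * mdist x z)%R ->
      (mdist (f x) (f y) <= M * mdist (f x) (f z))%R.
Proof.
move=> [[g [fg gf cf cg]] [eta [_ [_ _ _ ceta _]] qs]] T0.
have ceta' : {within `[0%R, T], continuous eta}.
  apply: continuous_subspaceW ceta => t /=; rewrite !in_itv /= andbT.
  by move=> /andP[].
have [c _ hc] := EVT_max T0 ceta'.
exists (Num.max 1%R (eta c)); first by rewrite le_max lexx.
move=> x y z xz xyT.
have d0 : (0 < mdist x z)%R by rewrite mdist_gt0; exact/eqP.
have [->|/eqP xy] := eqVneq x y;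
  first by rewrite mdistxx mulr_ge0 ?mdist_ge0// le_max ler01.
have [->|/eqP yz] := eqVneq y z;
  first by rewrite ler_peMl ?mdist_ge0// le_max lexx.
have := qs x y z xy yz xz.
have fd0 : (0 < mdist (f x) (f z))%R.
  by rewrite mdist_gt0; apply/eqP => /(can_inj fg).
rewrite ler_pdivrMr// => /le_trans; apply; rewrite ler_pM2r// le_max.
apply/orP; right; apply: hc; rewrite in_itv /= divr_ge0 ?mdist_ge0//=.
by rewrite ler_pdivrMr.
Qed.

(** The upper bound extends to all radii: beyond the diameter a ball is the whole space, which is
    also the ball whose radius equals the diameter. *)
Lemma ahlfors_bounds (q : R) : (0 < q)%R -> ahlfors_regular q Y ->
  0 < diam [set: Y] ->
  exists2 K : R, (1 <= K)%R & forall (y : Y) (r : R), (0 < r)%R ->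
    hausdorff_measure q (cball y r) <= (K * r `^ q)%:E /\
    (r%:E <= diam [set: Y] ->
      (K^-1 * r `^ q)%:E <= hausdorff_measure q (cball y r)).
Proof.
move=> q0 [K K1 hK] d0; exists K => // y r r0; split; last first.
  by move=> rd; have /andP[] := hK y r r0 rd.
have [rd|dr] := leP r%:E (diam [set: Y]); first by have /andP[] := hK y r r0 rd.
have dfin : diam [set: Y] \is a fin_num by rewrite ge0_fin_numE ?diam_ge0//
  (lt_trans dr) ?ltry.
have dE := fineK dfin; set d := fine _ in dE.
have dr' : (d < r)%R by rewrite -lte_fin dE.
have d0' : (0 < d)%R by rewrite -lte_fin dE.
have /andP[_ hd] := hK y d d0' (eq_ind_r (fun t => t <= _) (lexx _) dE).
apply: (@le_trans _ _ (K * d `^ q)%:E).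
  apply: le_trans hd; apply: le_hausdorff_measure => z _.
  by rewrite /cball /= -lee_fin dE; exact: mdist_le_diam.
rewrite lee_fin ler_wpM2l ?(le_trans ler01)// ge0_ler_powR ?nnegrE ?ltW//.
Qed.

Lemma uniformly_perfect_neq (x : X) : uniformly_perfect X ->
  exists z : X, x <> z.
Proof.
move=> [single _]; apply: contrapT => /forallNP h; apply: single; exists x.
by apply/seteqP; split=> // z _; have /contrapT := h z.
Qed.

Lemma quasisymmetric_pullback_doubling (q : R) (f : X -> Y) (q0 : (0 < q)%R) :
  uniformly_perfect X -> ahlfors_regular q Y -> quasisymmetric f ->
  doubling_measures X (pullback_outer (hausdorff_outer (X := Y) q0) f).
Proof.
move=> upX aY qsf; have homf : homeomorphism f by case: qsf.
split; first by apply: pullback_borel_regular => //;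
  exact: hausdorff_borel_regular.
have [g [fg gf _ _]] := homf.
(* The empty space satisfies [uniformly_perfect]; the doubling condition is then vacuous. *)
have [x0|noX] := pselect (exists x0 : X, True); last first.
  by exists 1%R => // x; have := noX (ex_intro _ x I).
have dYxz x z : x <> z -> 0 < (mdist (f x) (f z))%:E.
  by move=> xz; rewrite lte_fin mdist_gt0; apply/eqP => /(can_inj fg).
have dY : 0 < diam [set: Y].
  have [x _] := x0; have [z xz] := uniformly_perfect_neq x upX.
  exact: lt_le_trans (dYxz _ _ xz) (mdist_le_diam I I).
have [K K1 hK] := ahlfors_bounds q0 aY dY.
have K0 : (0 < K)%R by exact: lt_le_trans K1.
have [_ [D D1 hD]] := upX.
(* The ratio [2 * D] covers the points of [cball x (2 * r)] compared with a point [z] at distance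
   more than [r / D]. *)
have [|M M1 hM] := quasisymmetric_weak (T := (2 * D)%R) qsf; first by lra.
have M0 : (0 < M)%R by exact: lt_le_trans M1.
have powge1 (t : R) : (1 <= t)%R -> (1 <= t `^ q)%R.
  by move=> t1; rewrite -(powRr0 t) ler_powR// ltW.
(* With [s = mdist (f x) (f z)], this is the quotient of the upper bound [K * (M * s) ^ q] by the
   lower bound [K^-1 * (s / (2 * M)) ^ q]. *)
pose C := (K * K * (M * (2 * M)) `^ q)%R.
have M21 : (1 <= M * (2 * M))%R by nra.
have C1 : (1 <= C)%R.
  by rewrite /C -[leLHS]mulr1 ler_pM ?powge1// -[leLHS]mulr1 ler_pM.
exists C => // x r r0; set nu := pullback_outer _ _.
suff [a [b [a0 ha hb bC]]] : exists a b : R, [/\ (0 < a)%R,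
  a%:E <= nu (cball x r),
    nu (cball x (2 * r)%R) <= b%:E & nu (cball x (2 * r)%R) <= C%:E * nu (cball
      x r)].
  have le2 : nu (cball x r) <= nu (cball x (2 * r)%R).
    by apply: le_outer_measure => y; rewrite /cball /= => ?; lra.
  split=> //; first by apply: lt_le_trans le2; apply: lt_le_trans ha;
    rewrite lte_fin.
  have := le_trans le2 hb; have := outer_measure_ge0 nu (cball x r).
  by case: (nu (cball x r)) => // s _ _; rewrite -EFinM ltry.
have hle z s A : (0 < s)%R -> f @` A `<=` cball (f z) s ->
  nu A <= (K * s `^ q)%:E.
  move=> s0 fA; rewrite /nu pullback_outerE.
  apply: le_trans (proj1 (hK (f z) s s0)).
  exact: (le_outer_measure (hausdorff_outer (X := Y) q0)).
have hge z s A : (0 < s)%R -> s%:E <= diam [set: Y] ->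
  cball (f z) s `<=` f @` A ->
    (K^-1 * s `^ q)%:E <= nu A.
  move=> s0 sd fA; rewrite /nu pullback_outerE.
  apply: le_trans (proj2 (hK (f z) s s0) sd) _.
  exact: (le_outer_measure (hausdorff_outer (X := Y) q0)).
have [/(hD x r r0)[z [xz /negP zD]]|/set0P/negP/negPn/eqP XB] :=
    pselect ([set: X] `\` cball x r !=set0).
  rewrite -ltNge in zD; rewrite /cball /= in xz.
  have D0 : (0 < D)%R by exact: lt_le_trans D1.
  rewrite ltr_pdivrMr// in zD.
  have nxz : x <> z by move=> e; move: zD;
    rewrite -e mdistxx mul0r => /lt_trans/(_ r0); rewrite ltxx.
  pose s := mdist (f x) (f z).
  have s0 : (0 < s)%R by rewrite -lte_fin; exact: dYxz.
  have up : nu (cball x (2 * r)%R) <= (K * (M * s) `^ q)%:E.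
    apply: (hle x); first by rewrite mulr_gt0.
    move=> w; rewrite /cball /= => -[y xy <-]; apply: hM => //.
    by apply: (le_trans xy); rewrite -mulrA ler_pM2l// mulrC ltW.
  have low : (K^-1 * (s / (2 * M)) `^ q)%:E <= nu (cball x r).
    apply: (hge x).
    - by rewrite divr_gt0// mulr_gt0.
    - apply: (le_trans _ (mdist_le_diam (x := f x) (y := f z) I I)).
      rewrite lee_fin ler_pdivrMr ?mulr_gt0// ler_peMr ?mdist_ge0//; lra.
    (* If [g y'] were outside [cball x r], it would be farther from [x] than [z], and quasisymmetry
       would give [s <= M * mdist (f x) y' <= s / 2]. *)
    - move=> y' ; rewrite /cball /= => xy'; exists (g y'); last exact: gf.
      rewrite /= leNgt; apply/negP => rg.
      have xg : x <> g y' by move=> e; move: rg; rewrite -e mdistxx ltNge ltW.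
      have : (mdist x z <= 2 * D * mdist x (g y'))%R.
        by apply: le_trans xz _; apply: le_trans (ltW rg) _;
        rewrite ler_peMl ?mdist_ge0//; lra.
      move=> /(hM x z (g y') xg); rewrite gf -/s; move: xy'.
      rewrite ler_pdivlMr ?mulr_gt0//; nra.
  exists (K^-1 * (s / (2 * M)) `^ q)%R, (K * (M * s) `^ q)%R; split=> //.
    by rewrite mulr_gt0 ?invr_gt0// powR_gt0// divr_gt0// mulr_gt0.
  apply: (le_trans up);
    apply: (@le_trans _ _ (C%:E * (K^-1 * (s / (2 * M)) `^ q)%:E)); last first.
    by apply: lee_wpmul2l low; rewrite lee_fin (le_trans ler01).
  rewrite -EFinM lee_fin /C.
  have -> : (M * s = M * (2 * M) * (s / (2 * M)))%R by field; rewrite gt_eqF.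
  rewrite (@powRM _ (M * (2 * M))%R (s / (2 * M))%R q) ?divr_ge0 ?mulr_ge0
    ?(ltW M0) ?(ltW s0)//.
  by rewrite le_eqVlt; apply/orP; left; apply/eqP; field; rewrite gt_eqF.
have BT y : (mdist x y <= r)%R.
  by apply: contrapT => xy; have : ([set: X] `\` cball x r) y by []; rewrite XB.
have [z xz] := uniformly_perfect_neq x upX.
have dxz : (0 < mdist x z)%R by rewrite mdist_gt0; exact/eqP.
pose s := mdist (f x) (f z).
have s0 : (0 < s)%R by rewrite -lte_fin; exact: dYxz.
(* Here both balls are all of [X], so only positivity and finiteness are at stake and [M'] may
   depend on [x] and [r]. *)
have [|M' M'1 hM'] := quasisymmetric_weak (T := (r / mdist x z)%R) qsf.
  by rewrite divr_ge0// ltW.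
have M'0 : (0 < M')%R by exact: lt_le_trans M'1.
exists (K^-1 * s `^ q)%R, (K * (M' * s) `^ q)%R; split.
- by rewrite mulr_gt0 ?invr_gt0// powR_gt0.
- apply: (hge x) => //; first exact: mdist_le_diam.
  by move=> y' _; exists (g y'); [exact: BT|exact: gf].
- apply: (hle x); first by rewrite mulr_gt0.
  by move=> _ [y _ <-]; apply: hM' => //; rewrite divfK ?gt_eqF.
- apply: (@le_trans _ _ (nu (cball x r))).
    by apply: le_outer_measure => y _; exact: BT.
  rewrite -[leLHS]mul1e; apply: lee_wpmul2r; last by rewrite lee_fin.
  exact: outer_measure_ge0.
Qed.

End quasisymmetric_pullback.

Local Close Scope ereal_scope.

(** * The metric associated with a doubling measure *)

Lemma homeomorphism_inverse {S T : topologicalType} (f : S -> T) (g : T -> S) :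
  homeomorphism f -> cancel f g -> cancel g f -> homeomorphism g.
Proof.
move=> [g' [fg' gf' cf cg']] fg gf; exists f; split=> //.
by have -> : g = g' by apply/funext => y; rewrite -{1}(gf' y) fg.
Qed.

Section doubling.
Context {R : realType} {X : metricType R} (mu : {outer_measure set X ->
  \bar R}).
Variable C : R.
Hypothesis C1 : 1 <= C.
Hypothesis mu_cara : forall B : set X, borel B -> mu.-caratheodory B.
Hypothesis mu_doubling : forall (x : X) (r : R), 0 < r ->
  [/\ 0 < mu (cball x (2 * r)), mu (cball x (2 * r)) <= C%:E * mu (cball x r)
    & C%:E * mu (cball x r) < +oo]%E.

Let C0 : 0 < C. Proof. exact: lt_le_trans C1. Qed.

Definition ball_mass (x : X) (r : R) : R := fine (mu (cball x r)).
Local Notation m := ball_mass.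

Lemma ball_massE x r : mu (cball x r) = (m x r)%:E.
Proof.
rewrite /ball_mass fineK// ge0_fin_numE ?outer_measure_ge0//.
have r1 : 0 < `|r| + 1 by rewrite ltr_wpDl.
have [_ _] := mu_doubling x r1; apply: le_lt_trans.
apply: (@le_trans _ _ (mu (cball x (`|r| + 1)))).
  apply: le_outer_measure => y; rewrite /cball /= => /le_trans; apply.
  by rewrite (le_trans (ler_norm r))// lerDl.
by rewrite -[leLHS]mul1e; apply: lee_wpmul2r;
  rewrite ?outer_measure_ge0// lee_fin.
Qed.

Lemma ball_mass_ge0 x r : 0 <= m x r.
Proof. by rewrite -lee_fin -ball_massE outer_measure_ge0. Qed.

Lemma ball_mass_gt0 x r : 0 < r -> 0 < m x r.
Proof.
move=> r0; have r20 : 0 < r / 2 by rewrite divr_gt0.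
have [+ _ _] := mu_doubling x r20.
by rewrite mulrC divfK// ball_massE lte_fin.
Qed.

Lemma ball_mass_sub x y r s : cball x r `<=` cball y s -> m x r <= m y s.
Proof. by move=> xy; rewrite -lee_fin -!ball_massE;
  exact: le_outer_measure. Qed.

Lemma le_ball_mass x r s : r <= s -> m x r <= m x s.
Proof. by move=> rs; apply: ball_mass_sub => y; rewrite /cball /= => /le_trans;
  exact. Qed.

Lemma ball_mass_shift x y r s : mdist x y + r <= s -> m x r <= m y s.
Proof.
move=> rs; apply: ball_mass_sub => z; rewrite /cball /= => xz.
by have := metric_triangle y x z; rewrite (metric_sym y x); lra.
Qed.

Lemma ball_mass_exp x r n : 0 < r -> m x (2 ^+ n * r) <= C ^+ n * m x r.
Proof.
move=> r0; elim: n => [|n ih]; first by rewrite !expr0 !mul1r.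
have r20 : 0 < 2 ^+ n * r by rewrite mulr_gt0// exprn_gt0.
have [_ + _] := mu_doubling x r20; rewrite !ball_massE -EFinM lee_fin.
rewrite mulrA -exprS => /le_trans; apply.
by rewrite exprS -mulrA ler_pM2l.
Qed.

Lemma ball_mass_doubling x r s n : 0 < r -> s <= 2 ^+ n * r ->
  m x s <= C ^+ n * m x r.
Proof. by move=> r0 /(le_ball_mass x) /le_trans; apply;
  exact: ball_mass_exp. Qed.

(** If [C <= 2 ^ a] and [2 ^ j <= t < 2 ^ j.+1], then [j.+1] doublings cost at most
    [(2 ^ j.+1) ^ a <= (2 * t) ^ a]. *)
Lemma ball_mass_power_ge1 : exists a : nat, forall x r t, 0 < r -> 1 <= t ->
  m x (t * r) <= (2 * t) ^+ a * m x r.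
Proof.
have [a aC] := exists_exp_ge C; exists a => x r t r0 t1.
have [j /andP[jt tj]] := exp_sandwich (lexx 2) t1.
apply: (le_trans (@ball_mass_doubling x r (t * r) j.+1 r0 _)).
  by rewrite ler_pM2r// ltW.
rewrite ler_pM2r ?ball_mass_gt0//.
apply: (@le_trans _ _ ((2 ^+ a) ^+ j.+1));
  first by rewrite lerXn2r ?nnegrE ?exprn_ge0 ?(ltW C0).
rewrite exprAC lerXn2r ?nnegrE ?exprn_ge0//; first by rewrite mulr_ge0//; lra.
by rewrite exprS ler_pM2l.
Qed.

Hypothesis upX : uniformly_perfect X.

(* The ball [cball x s] misses a ball of comparable size centered at a point
   [z] with [2 * s < mdist x z <= 2 * D * s]. *)
Lemma ball_mass_reverse_doubling : exists L theta : R,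
  [/\ 2 <= L, 0 <= theta < 1 & forall x s, 0 < s ->
     (exists y, L * s < mdist x y) -> m x s <= theta * m x (L * s)].
Proof.
have [_ [D D1 hD]] := upX; have D0 : 0 < D by exact: lt_le_trans D1.
have [k kD] := exists_exp_ge (8 * D).
have Ck1 : 1 <= C ^+ k by rewrite exprn_ege1.
have Ck0 : 0 < C ^+ k by exact: lt_le_trans Ck1.
(* The ball about [z] fits into [cball x (4 * D * s)], which in turn lies in [cball z (8 * D * s)].
   So [cball z s] carries at least the fraction [C ^- k] of its mass. *)
exists (4 * D), (1 - (C ^+ k)^-1); split; first by lra.
  by rewrite subr_ge0 invf_le1// Ck1 /= ltrBlDr ltrDl invr_gt0.
move=> x s s0 [y ys].
have r0 : 0 < 2 * D * s by rewrite !mulr_gt0.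
have [|z [xz /negP zD]] := hD x (2 * D * s) r0.
  exists y; split=> //; apply/negP; rewrite -ltNge; apply: le_lt_trans ys.
  by rewrite ler_pM2r// ler_pM2r//; lra.
rewrite -ltNge in zD; rewrite /cball /= in xz zD.
have e2 : 2 * D * s / D = 2 * s by field; rewrite gt_eqF.
rewrite e2 in zD.
have Ds : s <= D * s by rewrite ler_peMl// ltW.
have sub1 : cball x s `<=` cball x (4 * D * s).
  by move=> w; rewrite /cball /= => xw; lra.
have sub2 : cball z s `<=` cball x (4 * D * s).
  move=> w; rewrite /cball /= => zw.
  by have := metric_triangle x z w; lra.
have := sum_caratheodory_le (mu := mu) (s := [:: true; false])
  (B := fun b => if b then cball x s else cball z s) (A := cball x (4 * D * s)).
have disj : cball x s `&` cball z s = set0.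
  rewrite -subset0 => w []; rewrite /cball /= => xw zw.
  by have := metric_triangle x w z; rewrite (metric_sym w z); lra.
rewrite !big_cons big_nil !ball_massE addr0 -EFinD lee_fin => /(_ isT) h.
have {}h : m x s + m z s <= m x (4 * D * s).
  apply: h => [[] _|[] _|[] [] _ _ _] //; rewrite ?(setIC (cball z s))//.
  - by apply: mu_cara; apply: closed_borel; exact: closed_cball.
  - by apply: mu_cara; apply: closed_borel; exact: closed_cball.
have h2 : m x (4 * D * s) <= C ^+ k * m z s.
  apply: le_trans (ball_mass_shift (y := z) (s := 8 * D * s) _) _; first by lra.
  by apply: ball_mass_doubling => //; rewrite ler_pM2r.
rewrite mulrBl mul1r lerBrDr; apply: le_trans h; rewrite lerD2l.
by rewrite ler_pdivrMl.
Qed.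

Lemma ball_mass_half : exists2 L : R, 2 <= L & forall x s, 0 < s ->
  (exists y, L * s < mdist x y) -> m x s <= m x (L * s) / 2.
Proof.
have [L [theta [L2 th hL]]] := ball_mass_reverse_doubling.
have [n hn] := exists_exp_le th (@divr_gt0 R 1 2 ltr01 (ltr0n _ 2)).
have L0 : 0 < L by lra.
have [th0 _] := andP th.
exists (L ^+ n.+1).
  by apply: (le_trans L2); rewrite -[leLHS]expr1 ler_weXn2l//; lra.
move=> x s s0 [y ys].
have key j : (j <= n.+1)%N -> m x s <= theta ^+ j * m x (L ^+ j * s).
  elim: j => [|j ih] jn; first by rewrite !expr0 !mul1r.
  apply: (le_trans (ih (ltnW jn))).
  rewrite exprSr -mulrA ler_wpM2l ?exprn_ge0//.
  rewrite (exprS L) -mulrA; apply: hL; first by rewrite mulr_gt0// exprn_gt0.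
  exists y; apply: le_lt_trans ys;
    rewrite mulrA -exprS ler_pM2r// ler_weXn2l//; lra.
apply: (le_trans (key n.+1 (leqnn _)));
  rewrite mulrC ler_wpM2l ?ball_mass_ge0//.
rewrite exprS -[2^-1]mul1r; apply: (le_trans _ hn).
by rewrite ler_piMl ?exprn_ge0// ltW; case/andP: th.
Qed.

(** Decay of order [t ^ (1 / b)], written with an integral power: dividing the radius by
    [L <= 2 ^ b] at least halves the mass. The reference radius is a distance [mdist x z] so that
    smaller balls are not the whole space. *)
Lemma ball_mass_power_le1 : exists (b : nat) (A : R), [/\ (0 < b)%N, 1 <= A &
  forall x z t, x <> z -> 0 < t <= 1 ->
    m x (t * mdist x z) ^+ b <= A * t * m x (mdist x z) ^+ b].
Proof.
have [L L2 hL] := ball_mass_half; have L0 : 0 < L by lra.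
have [b Lb] := exists_exp_ge L.
have b0 : (0 < b)%N by case: b Lb => // /le_trans/(_ (lexx _)); rewrite expr0;
  lra.
exists b, (2 * L); split=> //; first by lra.
move=> x z t xz /andP[t0 t1].
have r0 : 0 < mdist x z by rewrite mdist_gt0; exact/eqP.
have m0 := ball_mass_ge0 x.
have [t2|/ltW t2] := leP t (2^-1); last first.
  apply: (@le_trans _ _ (m x (mdist x z) ^+ b)).
    by rewrite lerXn2r ?nnegrE// le_ball_mass// ler_piMl// ltW.
  by rewrite ler_peMl ?exprn_ge0//; nra.
(* The factor 2 keeps [L ^ j * t] at most one half, so that [z] stays outside all the balls of the
   iteration. *)
have [|j /andP[jt tj]] := @exp_sandwich _ L ((2 * t)^-1) L2.
  by rewrite invf_ge1 ?mulr_gt0//; lra.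
have Lj0 : 0 < L ^+ j by rewrite exprn_gt0.
have iter i s : 0 < s -> (exists y, L ^+ i * s < mdist x y) ->
    2 ^+ i * m x s <= m x (L ^+ i * s).
  elim: i => [|i ih] s0 [y ys]; first by rewrite !expr0 !mul1r.
  have Lis : 0 < L ^+ i * s by rewrite mulr_gt0// exprn_gt0.
  rewrite !exprS -!mulrA in ys *.
  have := hL x _ Lis (ex_intro _ y ys); rewrite ler_pdivlMr// mulrC;
    apply: le_trans.
  rewrite ler_pM2l//; apply: ih => //; exists y; apply: le_lt_trans ys.
  by rewrite ler_peMl ?(ltW Lis)//; lra.
have le1 : L ^+ j * (t * mdist x z) <= mdist x z / 2.
  rewrite mulrA [leRHS]mulrC ler_pM2r//.
  by move: jt; rewrite invfM -ler_pdivrMr ?invr_gt0// invrK.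
have : 2 ^+ j * m x (t * mdist x z) <= m x (mdist x z).
  apply: le_trans (iter j _ _ _) _; first by rewrite mulr_gt0.
    by exists z; apply: le_lt_trans le1 _; lra.
  by apply: le_ball_mass; apply: (le_trans le1); lra.
move=> /(lerXn2r b); rewrite !nnegrE mulr_ge0 ?exprn_ge0// => /(_ isT (m0 _)).
rewrite exprMn => hb.
have Lt : 1 <= 2 * L * t * (2 ^+ j) ^+ b.
  have h1 : L ^+ j <= (2 ^+ j) ^+ b.
    by rewrite exprAC lerXn2r ?nnegrE ?exprn_ge0// ltW.
  apply: (@le_trans _ _ (2 * L * t * L ^+ j)).
    have : 1 <= L ^+ j.+1 * (2 * t) by rewrite -ler_pdivrMr ?mulr_gt0// mul1r
      ltW.
    by rewrite exprS; lra.
  by rewrite ler_pM2l// !mulr_gt0.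
apply: (@le_trans _ _ (2 * L * t * (2 ^+ j) ^+ b * m x (t * mdist x z) ^+ b)).
  by rewrite ler_peMl ?exprn_ge0.
by rewrite -mulrA ler_pM2l// !mulr_gt0.
Qed.

Lemma ball_mass_small x e : 0 < e -> exists2 r, 0 < r & m x r <= e.
Proof.
move=> e0; have [z xz] := uniformly_perfect_neq x upX.
have r0 : 0 < mdist x z by rewrite mdist_gt0; exact/eqP.
have [b [A [b0 A1 hA]]] := ball_mass_power_le1.
have A0 : 0 < A by exact: lt_le_trans A1.
pose M := m x (mdist x z) ^+ b;
  have M0 : 0 < M by rewrite exprn_gt0// ball_mass_gt0.
pose t := Num.min 1 (e ^+ b / (A * M)).
have t0 : 0 < t by rewrite lt_min ltr01 divr_gt0 ?mulr_gt0// exprn_gt0.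
exists (t * mdist x z); first by rewrite mulr_gt0.
rewrite -(@ler_pXn2r _ b) ?nnegrE ?ball_mass_ge0 ?(ltW e0)//.
apply: (le_trans (hA x z t xz _)); first by rewrite t0 ge_min lexx.
rewrite -/M mulrAC mulrC -ler_pdivlMr ?mulr_gt0//.
by rewrite ge_min lexx orbT.
Qed.

(** The value on the diagonal is imposed, so that the metrization does not rely on points being
    null. *)
Let mass_dist x y := if x == y then 0 else m x (mdist x y) + m y (mdist x y).

Let mass_dist_ge0 x y : 0 <= mass_dist x y.
Proof. by rewrite /mass_dist; case: ifP => // _;
  rewrite addr_ge0 ?ball_mass_ge0. Qed.

Let mass_dist_sym x y : mass_dist x y = mass_dist y x.
Proof. by rewrite /mass_dist eq_sym metric_sym addrC. Qed.

Let mass_dist_ge x y : x <> y -> m x (mdist x y) <= mass_dist x y.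
Proof. by move=> /eqP/negbTE xy; rewrite /mass_dist xy lerDl ball_mass_ge0. Qed.

Let mass_dist_le x y : x <> y -> mass_dist x y <= (1 + C) * m x (mdist x y).
Proof.
move=> xy; have r0 : 0 < mdist x y by rewrite mdist_gt0; exact/eqP.
move/eqP/negbTE: (xy) => xyF; rewrite /mass_dist xyF mulrDl mul1r lerD2l.
apply: le_trans (ball_mass_shift (y := x) (s := 2 * mdist x y) _) _.
  by rewrite (metric_sym y x); lra.
by have := ball_mass_exp x 1 r0; rewrite !expr1.
Qed.

(** Let [u v] be the longest of the three steps. The ball about [u] of radius [8 * mdist u v]
    contains those of radius [mdist a d] about [a] and [d]: three doublings give [C ^ 3], the two
    balls the factor 2. *)
Let mass_dist_quasi a b c d s : mass_dist a b <= s -> mass_dist b c <= s ->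
  mass_dist c d <= s -> mass_dist a d <= 2 * C ^+ 3 * s.
Proof.
move=> ab bc cd; have s0 : 0 <= s := le_trans (mass_dist_ge0 a b) ab.
have [->|/eqP ad] := eqVneq a d.
  by rewrite /mass_dist eqxx; do 2![apply: mulr_ge0 => //]; exact/exprn_ge0/ltW.
have adF : (a == d) = false by apply/negbTE/eqP.
have t1 := metric_triangle a b d; have t2 := metric_triangle b c d.
have t3 := metric_triangle a b c.
have far u v : mdist a u + mdist a d <= 8 * mdist u v ->
    mdist d u + mdist a d <= 8 * mdist u v -> mass_dist u v <= s ->
    mass_dist a d <= 2 * C ^+ 3 * s.
  move=> au du uvs.
  have uv : u <> v.
    move=> e; move: au; rewrite e mdistxx mulr0 => h.
    have := mdist_ge0 a v; have : 0 < mdist a d by rewrite mdist_gt0; exact/eqP.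
    lra.
  have ms : m u (mdist u v) <= s by exact: le_trans (mass_dist_ge uv) uvs.
  have m8 : m u (8 * mdist u v) <= C ^+ 3 * s.
    apply: (@le_trans _ _ (C ^+ 3 * m u (mdist u v))).
      apply: ball_mass_doubling; first by rewrite mdist_gt0; exact/eqP.
      by rewrite ler_wpM2r ?mdist_ge0//; lra.
    by rewrite ler_pM2l// exprn_gt0.
  have ma : m a (mdist a d) <= C ^+ 3 * s.
    by apply: le_trans m8; exact: ball_mass_shift.
  have md : m d (mdist a d) <= C ^+ 3 * s.
    by apply: le_trans m8; exact: ball_mass_shift.
  by rewrite /mass_dist adF -mulrA; lra.
have := mdist_ge0 a b; have := mdist_ge0 b c; have := mdist_ge0 c d => h1 h2 h3.
have [bcab|/ltW bcab] := leP (mdist b c) (mdist a b).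
  have [cdab|/ltW cdab] := leP (mdist c d) (mdist a b).
    by apply: (far a b) => //; rewrite ?mdistxx ?(metric_sym d a); lra.
  by apply: (far c d) => //; rewrite ?(metric_sym d c); lra.
have [cdbc|/ltW cdbc] := leP (mdist c d) (mdist b c).
  by apply: (far b c) => //; rewrite ?(metric_sym d b); lra.
by apply: (far c d) => //; rewrite ?(metric_sym d c); lra.
Qed.

(* For [q] large the power [1 / q] of the quasi-metric [mass_dist] satisfies the
   hypothesis of the metrization lemma [frink_chain]. *)
Lemma exists_ball_mass_metric :
  exists (Y : metricType R) (f : X -> Y) (g : Y -> X) (q : nat) (B : R),
  [/\ (0 < q)%N, 1 <= B, cancel f g, cancel g f & forall x y, x <> y ->
    m x (mdist x y) <= B * mdist (f x) (f y) ^+ q /\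
    mdist (f x) (f y) ^+ q <= B * m x (mdist x y)].
Proof.
have [n hn] := exists_exp_ge (2 * C ^+ 3); pose q := n.+1.
have q0 : 0 < q%:R :> R by rewrite ltr0n.
pose del x y := mass_dist x y `^ q%:R^-1.
have delX x y : del x y ^+ q = mass_dist x y.
  by rewrite -powR_mulrn ?powR_ge0// powRVK.
have del_leP x y s : 0 <= s -> (del x y <= s) = (mass_dist x y <= s ^+ q).
  by move=> s0; rewrite -delX ler_pXn2r ?nnegrE ?powR_ge0.
have del0 x y : 0 <= del x y by exact: powR_ge0.
have delxx x : del x x = 0.
  by rewrite /del /mass_dist eqxx powR0// invr_eq0 gt_eqF.
have del_sym x y : del x y = del y x by rewrite /del mass_dist_sym.
have del_eq0 x y : del x y = 0 -> x = y.
  move=> e; apply: contrapT => xy; have := mass_dist_ge xy.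
  rewrite -delX e expr0n /= leNgt ball_mass_gt0// mdist_gt0; exact/eqP.
have del_quasi a b c d s :
    del a b <= s -> del b c <= s -> del c d <= s -> del a d <= 2 * s.
  move=> ab; have s0 : 0 <= s := le_trans (del0 a b) ab; move: ab.
  rewrite !del_leP ?mulr_ge0// => ab bc cd.
  apply: (le_trans (mass_dist_quasi ab bc cd)).
  rewrite exprMn ler_wpM2r ?exprn_ge0//; apply: (le_trans hn).
  by rewrite ler_weXn2l//; lra.
have [Y [f [g [fg gf fE]]]] := exists_metric_structure
  (chain_distxx del0 delxx) (chain_dist_eq0 del0 delxx del_eq0 del_quasi)
  (chain_dist_sym del0 del_sym) (chain_dist_triangle del0).
have p4 : 1 <= 4 ^+ q :> R by rewrite exprn_ege1//; lra.
(* The factor [1 + C] compares [mass_dist] with the mass of one ball; [4 ^ q] is the loss in Frink's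
   lemma. *)
have B1 : 1 <= (1 + C) * 4 ^+ q.
  by apply: mulr_ege1 p4; rewrite lerDl ltW.
exists Y, f, g, q, ((1 + C) * 4 ^+ q); split=> //.
move=> x y xy; have := mdist_ge0 (f x) (f y); rewrite fE => rho0.
split.
  apply: (le_trans (mass_dist_ge xy)); rewrite -delX.
  apply: (@le_trans _ _ ((4 * chain_dist del x y) ^+ q)).
    rewrite lerXn2r ?nnegrE ?mulr_ge0//.
    exact: (delta_le_chain_dist del0 delxx del_eq0 del_quasi).
  by rewrite exprMn ler_wpM2r ?exprn_ge0// ler_peMl ?exprn_ge0// lerDl ltW.
apply: (@le_trans _ _ (mass_dist x y)).
  by rewrite -delX lerXn2r ?nnegrE// chain_dist_le_delta.
apply: (le_trans (mass_dist_le xy)); rewrite ler_wpM2r ?ball_mass_ge0//.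
by rewrite ler_peMr// addr_ge0// ltW.
Qed.

(** * Quasisymmetry and regularity of the new metric *)

Section ball_mass_metric.
Context {Y : metricType R} (f : X -> Y) (g : Y -> X) (q : nat) (B : R).
Hypotheses (q0 : (0 < q)%N) (B1 : 1 <= B) (fg : cancel f g) (gf : cancel g f).
Hypothesis mass_le : forall x y, x <> y ->
  m x (mdist x y) <= B * mdist (f x) (f y) ^+ q.
Hypothesis dist_le : forall x y, x <> y ->
  mdist (f x) (f y) ^+ q <= B * m x (mdist x y).

Let B0 : 0 < B. Proof. exact: lt_le_trans B1. Qed.

Let dist_small x e : 0 < e -> exists2 r, 0 < r &
  forall y, mdist x y <= r -> mdist (f x) (f y) <= e.
Proof.
move=> e0; have [|r r0 hr] := @ball_mass_small x (e ^+ q / B).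
  by rewrite divr_gt0// exprn_gt0.
exists r => // y xyr; have [<-|/eqP xy] := eqVneq x y;
  first by rewrite mdistxx ltW.
rewrite -(@ler_pXn2r _ q) ?nnegrE ?mdist_ge0 ?(ltW e0)//.
apply: (le_trans (dist_le xy)); rewrite mulrC -ler_pdivlMr//.
exact: le_trans (le_ball_mass x xyr) hr.
Qed.

Let dist_large x r : 0 < r -> exists2 e, 0 < e &
  forall y, mdist (f x) (f y) < e -> mdist x y < r.
Proof.
move=> r0; have m0 := ball_mass_gt0 x r0;
  have q0' : 0 < q%:R :> R by rewrite ltr0n.
exists ((m x r / B) `^ q%:R^-1); first by rewrite powR_gt0// divr_gt0.
move=> y; apply: contraTT; rewrite -!leNgt => rxy.
have xy : x <> y by move=> e; move: rxy; rewrite e mdistxx leNgt r0.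
rewrite -(@ler_pXn2r _ q) ?nnegrE ?mdist_ge0 ?powR_ge0//.
rewrite -powR_mulrn ?powR_ge0// powRVK ?divr_ge0 ?(ltW m0) ?(ltW B0)//.
rewrite ler_pdivrMr// mulrC; apply: le_trans (mass_le xy).
exact: le_ball_mass.
Qed.

Lemma ball_mass_metric_homeomorphism : homeomorphism f.
Proof.
exists g; split=> //.
- move=> x; apply/metricType_numDomainType.cvgrPdist_lt => e e0.
  have [r r0 hr] := dist_small x (divr_gt0 e0 (ltr0n R 2)).
  apply/metricType_numDomainType.nbhs_mdistP; exists r => //= y /= /ltW /hr;
    lra.
- move=> y; apply/metricType_numDomainType.cvgrPdist_lt => r r0.
  have [e e0 he] := dist_large (g y) r0.
  apply/metricType_numDomainType.nbhs_mdistP; exists e => //= z /= yz.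
  by apply: he; rewrite !gf.
Qed.

Lemma ball_mass_metric_quasisymmetric : quasisymmetric f.
Proof.
split; first exact: ball_mass_metric_homeomorphism.
have [a ha] := ball_mass_power_ge1;
  have [b [A [b0 A1 hA]]] := ball_mass_power_le1.
(* The sum dominates both constants: the first is needed for [t >= 1], the second for [t <= 1]. *)
pose P := B ^+ 2 * 2 ^+ a + (B ^+ 2) ^+ b * A.
have B2 : 1 <= B ^+ 2 by rewrite exprn_ege1.
have P1 : 1 <= B ^+ 2 * 2 ^+ a.
  by apply: mulr_ege1 => //; rewrite exprn_ege1//; lra.
have P2 : 1 <= (B ^+ 2) ^+ b * A by apply: mulr_ege1 => //; rewrite exprn_ege1.
have N0 : (0 < a + q * b)%N by rewrite addn_gt0 muln_gt0 q0 b0 orbT.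
exists (power_max P (a + q * b)%:R).
  by apply: power_max_homeomorphism; [rewrite /P; lra|rewrite ler1n].
move=> x y z xy yz xz.
have d0 : 0 < mdist x z by rewrite mdist_gt0; exact/eqP.
have dy0 : 0 < mdist x y by rewrite mdist_gt0; exact/eqP.
set t := mdist x y / mdist x z; have t0 : 0 < t by rewrite divr_gt0.
have tE : mdist x y = t * mdist x z by rewrite divfK// gt_eqF.
have s0 : 0 < mdist (f x) (f z) by rewrite mdist_gt0;
  apply/eqP => /(can_inj fg).
have m0 := ball_mass_gt0 x d0.
have ratio : (mdist (f x) (f y) / mdist (f x) (f z)) ^+ q <=
    B ^+ 2 * (m x (t * mdist x z) / m x (mdist x z)).
  rewrite expr_div_n ler_pdivrMr ?exprn_gt0//.
  apply: (le_trans (dist_le xy)); rewrite -tE.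
  have k : 1 <= B * mdist (f x) (f z) ^+ q / m x (mdist x z).
    by rewrite ler_pdivlMr// mul1r; exact: mass_le.
  rewrite -[X in _ <= X](_ : B * m x (mdist x y) *
    (B * mdist (f x) (f z) ^+ q / m x (mdist x z)) = _); last by ring.
  by rewrite ler_peMr// mulr_ge0 ?ball_mass_ge0// ltW.
apply: le_power_max => //.
- by rewrite divr_ge0// mdist_ge0.
- by rewrite /P; lra.
- move=> t1; apply: (le_trans ratio).
  apply: (@le_trans _ _ (B ^+ 2 * 2 ^+ a * t ^+ a)); last first.
    by rewrite ler_pM2r ?exprn_gt0// /P; lra.
  rewrite -mulrA -exprMn ler_pM2l; last by lra.
  by rewrite ler_pdivrMr// ha.
- move=> t1; rewrite exprM.
  apply: (@le_trans _ _ ((B ^+ 2) ^+ b * A * t));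
    last by rewrite ler_pM2r// /P; lra.
  apply: (@le_trans _ _ ((B ^+ 2 * (m x (t * mdist x z) / m x (mdist x z))) ^+
    b)).
    rewrite lerXn2r ?nnegrE ?exprn_ge0// ?divr_ge0 ?mdist_ge0//.
    by apply: le_trans ratio; rewrite exprn_ge0// divr_ge0 ?mdist_ge0.
  rewrite exprMn -mulrA ler_pM2l; last by rewrite exprn_gt0//; lra.
  rewrite expr_div_n ler_pdivrMr ?exprn_gt0//; apply: hA => //.
  by rewrite t0.
Qed.

Let nu := pullback_outer mu g.

(** The factor [C ^ 2] pays for replacing extremal points by points at comparable distance, [4 ^ q]
    for a new ball that is the whole space. *)
Let K := B * C ^+ 2 * 4 ^+ q.

Let nu_ball x r : nu (cball (f x) r) = mu [set y | mdist (f x) (f y) <= r].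
Proof. by rewrite pullback_outerE (image_cancel _ gf fg). Qed.

Let nu_up (y : Y) r : 0 < r -> (nu (cball y r) <= (K * r `^ q%:R)%:E)%E.
Proof.
move=> r0; rewrite -(gf y) nu_ball; set x := g y; set G := [set _ | _].
pose c := B * r ^+ q; have c0 : 0 < c by rewrite mulr_gt0// exprn_gt0.
have cK : C ^+ 2 * c <= K * r `^ q%:R.
  rewrite powR_mulrn ?(ltW r0)// /c /K mulrA [C ^+ 2 * B]mulrC.
  by rewrite ler_pM2r ?exprn_gt0// ler_peMr ?exprn_ege1//;
    [rewrite mulr_ge0 ?exprn_ge0 ?ltW|lra].
have cK1 : c <= K * r `^ q%:R.
  by apply: le_trans cK; rewrite ler_peMl ?(ltW c0)// exprn_ege1.
have Gm z : G z -> x <> z -> m x (mdist x z) <= c.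
  move=> Gz xz; apply: (le_trans (mass_le xz)); rewrite /c ler_pM2l//.
  by rewrite lerXn2r ?nnegrE ?mdist_ge0 ?(ltW r0).
(* Either the whole space has mass at most [c], or some radius [t0] bounds [G], since [mass_le]
   bounds the mass up to a point of [G] by [c]. *)
have [[t0 ct0]|/forallNP all] := pselect (exists t, c < m x t); last first.
  apply: (@le_trans _ _ (mu (\bigcup_n cball x n%:R))).
    apply: le_outer_measure => z _; exists (Num.truncn (mdist x z)).+1 => //.
    by rewrite /cball /= ltW// truncnS_gt.
  apply: caratheodory_bigcup_le.
  - by move=> n; apply: mu_cara; apply: closed_borel; exact: closed_cball.
  - move=> i j ij; apply/subsetPset => z; rewrite /cball /= => /le_trans; apply.
    by rewrite ler_nat.
  - move=> n; rewrite ball_massE lee_fin; apply: le_trans cK1.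
    by rewrite leNgt; apply/negP/all.
have [[z [Gz xz]]|/forallNP none] := pselect (exists z, G z /\ x <> z);
  last first.
  have [s s0 ms] := ball_mass_small x c0.
  apply: (@le_trans _ _ (mu (cball x s))); last first.
    by rewrite ball_massE lee_fin (le_trans ms).
  apply: le_outer_measure => z Gz; have [<-|/eqP xz] := eqVneq x z.
    by rewrite /cball /= mdistxx ltW.
  by have := none z; case.
pose S := [set mdist x z | z in G].
have Sb w : G w -> mdist x w <= t0.
  move=> Gw; rewrite leNgt; apply/negP => t0w.
  have [xw|/eqP xw] := eqVneq x w; last first.
    by have := Gm w Gw xw; have := le_ball_mass x (ltW t0w); lra.
  move: t0w; rewrite -xw mdistxx => /ltW t00; have := Gm z Gz xz.
  by have := le_ball_mass x (le_trans t00 (mdist_ge0 x z)); lra.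
have supS : has_sup S by split;
  [exists (mdist x z), z|exists t0 => _ [w Gw <-]; exact: Sb].
have Sle w : G w -> mdist x w <= sup S by move=> Gw;
  apply: sup_upper_bound => //; exists w.
have S0 : 0 < sup S by apply: lt_le_trans (Sle z Gz); rewrite mdist_gt0;
  exact/eqP.
(* The supremum need not be attained; a point beyond half of it suffices, by doubling. *)
have [_ [w Gw <-] hw] :=
  @sup_adherent _ S (sup S / 2) (divr_gt0 S0 (ltr0n R 2)) supS.
have w0 : 0 < mdist x w by lra.
apply: (@le_trans _ _ (mu (cball x (sup S))));
  first by apply: le_outer_measure => v; exact: Sle.
rewrite ball_massE lee_fin; apply: le_trans cK.
apply: (@le_trans _ _ (C ^+ 2 * m x (mdist x w))).
  by apply: ball_mass_doubling => //; lra.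
rewrite ler_pM2l ?exprn_gt0//; apply: Gm => // e.
by move: w0; rewrite -e mdistxx ltxx.
Qed.

Let nu_low (y : Y) r : 0 < r -> (r%:E <= diam [set: Y])%E ->
  ((K^-1 * r `^ q%:R)%:E <= nu (cball y r))%E.
Proof.
move=> r0 rd; rewrite -(gf y) nu_ball; set x := g y; set G := [set _ | _].
have K1 : 1 <= C ^+ 2 * 4 ^+ q by apply: mulr_ege1; rewrite exprn_ege1//; lra.
have K0 : 0 < K by rewrite /K -mulrA mulr_gt0//; lra.
rewrite powR_mulrn ?(ltW r0)//.
pose c := B^-1 * r ^+ q;
  have c0 : 0 < c by rewrite mulr_gt0 ?invr_gt0// exprn_gt0.
have Gm z : m x (mdist x z) <= c -> G z.
  move=> mc; rewrite /G /=; have [<-|/eqP xz] := eqVneq x z;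
    first by rewrite mdistxx ltW.
  rewrite -(@ler_pXn2r _ q) ?nnegrE ?mdist_ge0 ?(ltW r0)//.
  by apply: (le_trans (dist_le xz)); rewrite -ler_pdivlMl.
have [[w0 Gw0]|/forallNP allG] := pselect (exists w, ~ G w); last first.
  (* Otherwise the diameter of [Y] would be at most [r / 2]. *)
  have [z zr] : exists z, r / 4 < mdist (f x) (f z).
    apply: contrapT => /forallNP h; have : (diam [set: Y] <= (r / 2)%:E)%E.
      apply: diam_le; first by rewrite lee_fin; lra.
      move=> u v _ _; rewrite lee_fin.
      have hu : mdist (f x) u <= r / 4 by rewrite -(gf u) leNgt; apply/negP/h.
      have hv : mdist (f x) v <= r / 4 by rewrite -(gf v) leNgt; apply/negP/h.
      by have := metric_triangle u (f x) v; rewrite (metric_sym u (f x)); lra.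
    by move=> /(le_trans rd); rewrite lee_fin; lra.
  have xz : x <> z by move=> e; move: zr; rewrite -e mdistxx; lra.
  apply: (@le_trans _ _ (mu (cball x (mdist x z)))); last first.
    by apply: le_outer_measure => v _; apply: contrapT; exact: allG.
  rewrite ball_massE lee_fin.
  have : (r / 4) ^+ q <= B * m x (mdist x z).
    apply: le_trans (dist_le xz); rewrite lerXn2r ?nnegrE ?mdist_ge0//;
      last exact: ltW.
    by lra.
  rewrite expr_div_n ler_pdivrMr ?exprn_gt0// => h.
  rewrite ler_pdivrMl//; apply: (le_trans h).
  have -> : B * m x (mdist x z) * 4 ^+ q = B * 4 ^+ q * m x (mdist x z) by ring.
  rewrite ler_wpM2r ?ball_mass_ge0// /K -mulrA ler_pM2l//.
  by rewrite ler_peMl ?exprn_ge0// exprn_ege1.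
(* Balls of small mass lie in [G], so its complement stays at distance at least [s1] from [x] and
   the infimum below is positive. *)
have [s1 s10 ms1] := ball_mass_small x c0.
pose V := [set mdist x z | z in ~` G].
have Vb w : ~ G w -> s1 <= mdist x w.
  move=> Gw; rewrite leNgt; apply/negP => ws; apply: Gw; apply: Gm.
  by apply: le_trans ms1; apply: le_ball_mass; exact: ltW.
have infV : has_inf V.
  by split; [exists (mdist x w0), w0|exists s1 => _ [w Gw <-]; exact: Vb].
have Vle w : ~ G w -> inf V <= mdist x w.
  by move=> Gw; apply: ge_inf; [case: infV|exists w].
have V0 : 0 < inf V.
  by apply: lt_le_trans s10 _; apply: lb_le_inf;
    [case: infV|move=> _ [w Gw <-]; exact: Vb].
(* With [inf V] itself as margin, [w] is outside [G] at distance less than [2 * inf V], four times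
   the radius of the ball placed inside [G]. *)
have [_ [w Gw <-] hw] := @inf_adherent _ V (inf V) V0 infV.
apply: (@le_trans _ _ (mu (cball x (inf V / 2)))); last first.
  apply: le_outer_measure => v; rewrite /cball /= => xv.
  by apply: contrapT => /Vle; lra.
rewrite ball_massE lee_fin.
have : c <= C ^+ 2 * m x (inf V / 2).
  apply: (@le_trans _ _ (m x (mdist x w))).
    by rewrite leNgt; apply/negP => /ltW /Gm.
  by apply: ball_mass_doubling; lra.
rewrite /c ler_pdivrMl// => h; rewrite ler_pdivrMl//; apply: (le_trans h).
rewrite mulrA ler_wpM2r ?ball_mass_ge0// /K ler_peMr ?exprn_ege1//; last by lra.
by rewrite mulr_ge0 ?exprn_ge0 ?ltW.
Qed.

Hypothesis mu_regular : borel_regular mu.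

Let q0' : 0 < q%:R :> R. Proof. by rewrite ltr0n. Qed.

Let K1 : 1 <= K.
Proof.
by rewrite /K; apply: mulr_ege1; [apply: mulr_ege1 => //|];
  rewrite exprn_ege1//; lra.
Qed.

Let nu_cara (F : set Y) : closed F -> nu.-caratheodory F.
Proof.
have hg := homeomorphism_inverse ball_mass_metric_homeomorphism fg gf.
by have [+ _] := pullback_borel_regular hg mu_regular => h /closed_borel /h.
Qed.

Let two_points (x : X) : exists a b : Y, a <> b.
Proof.
have [z xz] := uniformly_perfect_neq x upX.
by exists (f x), (f z) => /(can_inj fg).
Qed.

Let nu_image (A : set X) : nu (f @` A) = mu A.
Proof. by rewrite pullback_outerE image_comp eq_image_id// => x _ /=;
  rewrite fg. Qed.

Lemma ball_mass_metric_ahlfors : ahlfors_regular q%:R Y.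
Proof.
have [[x _]|noX] := pselect (exists x : X, True); last first.
  by exists 1 => // y; case: noX; exists (g y).
have [a [b ab]] := two_points x.
exact: (mass_ahlfors q0' K1 ab nu_cara nu_up nu_low).
Qed.

Lemma ball_mass_metric_mass_le :
  exists2 K : R, 0 < K & forall A : set X,
    (mu A <= K%:E * hausdorff_measure q%:R (f @` A))%E.
Proof.
exists K => [|A]; first exact: lt_le_trans K1.
by rewrite -nu_image; exact: (mass_le_hausdorff q0' K1 nu_up).
Qed.

Lemma ball_mass_metric_null (A : set X) :
  mu A = 0%E -> hausdorff_measure q%:R (f @` A) = 0%E.
Proof.
move=> A0; have [[x _]|noX] := pselect (exists x : X, True); last first.
  rewrite (_ : f @` A = set0) ?hausdorff_measure0//.
  by rewrite -subset0 => y [x]; case: noX; exists x.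
have [a [b ab]] := two_points x.
have [_ /(_ A)[B' [bB AB BA]]] := mu_regular.
have [g' [fg' gf' _ cg']] := ball_mass_metric_homeomorphism.
have bfB : borel (f @` B') by rewrite (image_cancel _ fg' gf');
  exact: borel_preimage.
have nB : nu (f @` B') = 0%E by rewrite nu_image BA.
have H0 := hausdorff_null q0' K1 ab nu_cara nu_up nu_low bfB nB.
apply/eqP; rewrite eq_le hausdorff_measure_ge0 andbT -H0.
by apply: le_hausdorff_measure => //; exact: image_subset.
Qed.

End ball_mass_metric.

End doubling.

Theorem proposition1p2 (R : realType) (X : metricType R) (E : set X)
    (hX : uniformly_perfect X) :
  (fat E <-> quasisymmetrically_thick E) /\
  (thin E <-> quasisymmetrically_null E).
Proof.
have pull (q : R) (Y : metricType R) (f : X ->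
  Y) (q0 : 0 < q) : ahlfors_regular q Y -> quasisymmetric f ->
    doubling_measures X (pullback_outer (hausdorff_outer (X := Y) q0) f).
  exact: quasisymmetric_pullback_doubling.
(* Fatness uses the implication between null sets, thinness the domination of [mu]. *)
have model mu : doubling_measures X mu ->
    exists (q : R) (Y : metricType R) (f : X -> Y) (K : R),
    [/\ 0 < q, ahlfors_regular q Y, quasisymmetric f,
        mu E = 0%E -> hausdorff_measure q (f @` E) = 0%E &
        (mu E <= K%:E * hausdorff_measure q (f @` E))%E].
  move=> [reg [C C1 dbl]]; have [cara _] := reg.
  have [Y [f [g [q [B [q0 B1 fg gf h]]]]]] := exists_ball_mass_metric C1 dbl.
  have h1 x y xy := proj1 (h x y xy); have h2 x y xy := proj2 (h x y xy).
  have [K _ hK] := ball_mass_metric_mass_le C1 cara dbl hX q0 B1 fg gf h1.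
  exists q%:R, Y, f, K; split=> //.
  - by rewrite ltr0n.
  - exact: (ball_mass_metric_ahlfors C1 cara dbl hX q0 B1 fg gf h1 h2 reg).
  - exact: (ball_mass_metric_quasisymmetric C1 cara dbl hX q0 B1 fg gf h1 h2).
  - exact: (ball_mass_metric_null C1 cara dbl hX q0 B1 fg gf h1 h2 reg).
split; split.
- by move=> fatE q Y f q0 aY qsf; exact: fatE _ (pull q Y f q0 aY qsf).
- move=> thick mu /model[q [Y [f [K [q0 aY qsf null _]]]]].
  rewrite lt0e outer_measure_ge0 andbT; apply/eqP => /null e.
  by have := thick q Y f q0 aY qsf; rewrite e ltxx.
- by move=> thinE q Y f q0 aY qsf; exact: thinE _ (pull q Y f q0 aY qsf).
- move=> null mu /model[q [Y [f [K [q0 aY qsf _]]]]].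
  rewrite (null q Y f q0 aY qsf) mule0 => le0.
  by apply/eqP; rewrite eq_le le0 outer_measure_ge0.
Qed.
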